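(* Let $\mathbb{X}$ be a finite-dimensional Euclidean space, $\mathbb{A},\mathbb{B}$ nonempty compact subsets of finite-dimensional Euclidean spaces, and $f:\mathbb{X}\times\mathbb{A}\times\mathbb{B}\to\mathbb{X}$, $g:\mathbb{X}\times\mathbb{A}\times\mathbb{B}\to[0,1]$ continuous with $\|f(x,a,b)-f(y,a,b)\|+|g(x,a,b)-g(y,a,b)|\le L\|x-y\|$ for some $L>0$ and all $x,y,a,b$. For $x_*\in\mathbb{X}$ and Borel measurable bounded controls $a:\mathbb{R}_+\to\mathbb{A}$, $b:\mathbb{R}_+\to\mathbb{B}$ let $y(\cdot;x_*,a,b)$ be the solution of $\dot x=f(x,a(t),b(t))$, $x(0)=x_*$. Let $\Omega\subset\mathbb{X}$ be nonempty and strongly invariant: $y(t;x_*,a,b)\in\Omega$ for all $x_*\in\Omega$, $t\ge0$ and all such controls $a,b$. For $\varrho\in\mathfrak{D}$, $x_*\in\Omega$ define $$\mathcal{V}[\varrho](x_* )=\inf_{\alpha\in\mathcal{A}}\sup_{b}\int_0^\infty\varrho(t)g\big(y(t;x_*,\alpha(b),b),\alpha(b)(t),b(t)\big)dt,$$ the supremum being over all Borel measurable bounded $b:\mathbb{R}_+\to\mathbb{B}$. Then for every $U_*:\Omega\to[0,1]$ the following are equivalent: (c) for every density $\mu\in\mathfrak{D}$ piecewise continuous on $(0,\infty)$, $\lim_{\lambda\to+0}\sup_{\omega\in\Omega}|\mathcal{V}[\mu^\lambda_{\mathrm{scale}}](\omega)-U_*(\omega)|=0$; (u) $\lim_{T\to+\infty}\sup_\omega|\mathcal{V}[\varpi_T](\omega)-U_*(\omega)|=0$;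 (e) $\lim_{\lambda\to+0}\sup_\omega|\mathcal{V}[\pi_\lambda](\omega)-U_*(\omega)|=0$; (p) for some power density $\varrho\in\mathfrak{D}$, $\lim_{T\to+\infty}\sup_\omega|\mathcal{V}[\varrho^T_{\mathrm{shift}}](\omega)-U_*(\omega)|=0$; (q) this holds for every power density $\varrho\in\mathfrak{D}$. Moreover, if for some $\mu\in\mathfrak{D}$ piecewise continuous on $(0,\infty)$ and some power density $\varrho$ one of the limits $\lim_{T\to\infty}\mathcal{V}[\varpi_T]$, $\lim_{\lambda\to+0}\mathcal{V}[\pi_\lambda]$, $\lim_{T\to\infty}\mathcal{V}[\varrho^T_{\mathrm{shift}}]$ exists uniformly on $\Omega$, then these and $\lim_{\lambda\to+0}\mathcal{V}[\mu^\lambda_{\mathrm{scale}}]$ all exist uniformly on $\Omega$, coincide and do not depend on the choice of $\mu$ and $\varrho$.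
   Context: $\mathbb{R}_+=[0,\infty)$. A quasistrategy (Elliott–Kalton strategy) of the first player is a map $\alpha$ from the set of Borel measurable bounded $b:\mathbb{R}_+\to\mathbb{B}$ to the set of Borel measurable bounded $a:\mathbb{R}_+\to\mathbb{A}$ such that for every $t>0$, $b|_{[0,t]}=b'|_{[0,t]}$ implies $\alpha[b]|_{[0,t]}=\alpha[b']|_{[0,t]}$; $\mathcal{A}$ is the set of all quasistrategies. $\mathfrak{D}$: probability densities $\varrho:\mathbb{R}_+\to\mathbb{R}_+$. For $T>0$ with $\int_T^\infty\varrho>0$: $\varrho^T_{\mathrm{shift}}(t)=\varrho(t+T)/\int_T^\infty\varrho$; for $\lambda>0$: $\varrho^\lambda_{\mathrm{scale}}(t)=\lambda\varrho(\lambda t)$. $\varpi_T(t)=\frac1T1_{[0,T]}(t)$, $\pi_\lambda(t)=\lambda e^{-\lambda t}$. A power density is $\varrho\in\mathfrak{D}$ with $\varrho(t)=(\alpha+\beta t)^{-\gamma}$ for some $\alpha,\beta,\gamma>0$. *)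

(* Defs.v *)
From HB Require Import structures.
From mathcomp Require Import all_boot all_order all_algebra.
From mathcomp Require Import all_classical all_reals all_analysis.
From Stdlib Require Import ClassicalEpsilon.
Set Implicit Arguments. Unset Strict Implicit. Unset Printing Implicit Defensive.
Import Order.TTheory GRing.Theory Num.Theory.
Import numFieldNormedType.Exports.
Local Open Scope classical_set_scope.
Local Open Scope ring_scope.

Section Defs.
Variable R : realType.
Local Notation leb := (@lebesgue_measure R).

Definition Rplus : set R := [set t | 0 <= t].

(** Borel measurability of a map into R^k (= 'rV[R]_k), via its coordinates
    (the Borel sigma-algebra of R^k is the product of the coordinate ones). *)
Definition borel_vec (k : nat) (D : set R) (a : R -> 'rV[R]_k) : Prop :=
  forall i : 'I_k, measurable_fun D (fun t => a t ord0 i).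

Definition control (k : nat) (K : set 'rV[R]_k) (a : R -> 'rV[R]_k) : Prop :=
  (forall t, 0 <= t -> K (a t)) /\ borel_vec Rplus a /\
  exists M : R, forall t, 0 <= t -> `|a t| <= M.

Definition quasistrategy (p q : nat) (A : set 'rV[R]_p) (B : set 'rV[R]_q)
  (alpha : (R -> 'rV[R]_q) -> (R -> 'rV[R]_p)) : Prop :=
  (forall b, control B b -> control A (alpha b)) /\
  (forall b b' t, control B b -> control B b' -> 0 < t ->
     (forall s, 0 <= s <= t -> b s = b' s) ->
     forall s, 0 <= s <= t -> alpha b s = alpha b' s).

(** y is a (Caratheodory) solution of x' = f(x, a(t), b(t)), x(0) = x0 on R_+. *)
Definition is_solution (n p q : nat)
  (f : 'rV[R]_n -> 'rV[R]_p -> 'rV[R]_q -> 'rV[R]_n)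
  (x0 : 'rV[R]_n) (a : R -> 'rV[R]_p) (b : R -> 'rV[R]_q) (y : R -> 'rV[R]_n) : Prop :=
  forall t, 0 <= t -> forall i : 'I_n,
    leb.-integrable [set s : R | (0 <= s <= t)%R] (fun s => ((f (y s) (a s) (b s)) ord0 i)%:E) /\
    (\int[leb]_(s in [set s : R | (0 <= s <= t)%R]) ((f (y s) (a s) (b s)) ord0 i)%:E =
       ((y t ord0 i) - (x0 ord0 i))%:E)%E.

(** the solution y(.; x0, a, b) (unique under the standing hypotheses) *)
Definition traj (n p q : nat)
  (f : 'rV[R]_n -> 'rV[R]_p -> 'rV[R]_q -> 'rV[R]_n)
  (x0 : 'rV[R]_n) (a : R -> 'rV[R]_p) (b : R -> 'rV[R]_q) : R -> 'rV[R]_n :=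
  epsilon (inhabits (fun _ => x0)) (is_solution f x0 a b).

Definition density (rho : R -> R) : Prop :=
  (forall t, 0 <= t -> 0 <= rho t) /\ measurable_fun Rplus rho /\
  (\int[leb]_(t in Rplus) (rho t)%:E = 1)%E.

Definition rho_shift (rho : R -> R) (T : R) : R -> R :=
  fun t => rho (t + T) / fine (\int[leb]_(s in [set s | T <= s]) (rho s)%:E).

Definition rho_scale (rho : R -> R) (lam : R) : R -> R :=
  fun t => lam * rho (lam * t).

Definition varpi (T : R) : R -> R := fun t => if (0 <= t <= T) then T^-1 else 0.

Definition pi_exp (lam : R) : R -> R := fun t => lam * expR (- (lam * t)).

Definition power_density (rho : R -> R) : Prop :=
  density rho /\ exists al be ga : R, 0 < al /\ 0 < be /\ 0 < ga /\
    forall t, 0 <= t -> rho t = (al + be * t) `^ (- ga).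

Definition piecewise_continuous (rho : R -> R) : Prop :=
  forall u v : R, 0 < u -> u <= v ->
    exists s : seq R,
      (forall t, u <= t <= v -> t \notin s -> {for t, continuous rho}) /\
      (forall t, t \in s -> (exists l : R, rho x @[x --> t^'-] --> l) /\
                            (exists l : R, rho x @[x --> t^'+] --> l)).

Definition payoff (n p q : nat)
  (f : 'rV[R]_n -> 'rV[R]_p -> 'rV[R]_q -> 'rV[R]_n)
  (g : 'rV[R]_n -> 'rV[R]_p -> 'rV[R]_q -> R)
  (rho : R -> R) (x0 : 'rV[R]_n) (a : R -> 'rV[R]_p) (b : R -> 'rV[R]_q) : \bar R :=
  \int[leb]_(t in Rplus) (rho t * g (traj f x0 a b t) (a t) (b t))%:E.

Definition value (n p q : nat) (A : set 'rV[R]_p) (B : set 'rV[R]_q)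
  (f : 'rV[R]_n -> 'rV[R]_p -> 'rV[R]_q -> 'rV[R]_n)
  (g : 'rV[R]_n -> 'rV[R]_p -> 'rV[R]_q -> R)
  (rho : R -> R) (x0 : 'rV[R]_n) : R :=
  fine (ereal_inf [set ereal_sup [set payoff f g rho x0 (alpha b) b | b in control B]
                  | alpha in quasistrategy A B]).

Definition sup_dev (n : nat) (Om : set 'rV[R]_n) (F U : 'rV[R]_n -> R) : \bar R :=
  ereal_sup [set (`|F w - U w|)%:E | w in Om].

End Defs.

(* Main.v *)
Require Import Defs.
From HB Require Import structures.
From mathcomp Require Import all_boot all_order all_algebra.
From mathcomp Require Import all_classical all_reals all_analysis measurable_realfun.
From mathcomp Require Import ring lra.
From Stdlib Require Import ClassicalEpsilon.
Set Implicit Arguments. Unset Strict Implicit. Unset Printing Implicit Defensive.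
Import Order.TTheory GRing.Theory Num.Theory.
Import numFieldNormedType.Exports.
Local Open Scope classical_set_scope.
Local Open Scope ring_scope.

(** The value [V r] makes sense for every integrable weight [r >= 0]; it is positively homogeneous
    and 1-Lipschitz in the L1 norm. The only game-theoretic input is the dynamic programming
    principle: switching strategies at a time [h] bounds [|V r - V r'|] by the L1 distance of [r]
    and [r'] on [[0, h]] plus the uniform distance of the values of the weights shifted by [h].

    Uniform densities imply all densities: approximate the density in L1 by a positive step
    function. A step of height [c] followed by a tail of mass [m] is compared with the single box of
    height [c] and the same total mass, whose value is known; induct on the number of steps.

    Conversely, exponential and power densities reproduce themselves, up to scaling, under
    shifts. Cut [[0, N tau]] into [N] blocks. With [k] blocks left, compare the box with [k] times
    the scaled density that has the same height at 0: they differ on one block by [O(1/k)], and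
    both tails are again of the same kind. The errors sum to [O(log N)] against a total mass [N]. *)

(** * Measurability and change of variables *)

Section AffineChangeOfVariables.
Variable R : realType.
Local Notation leb := (@lebesgue_measure R).
Implicit Types (l h : R) (D : set R).

Lemma measurable_affine l h :
  measurable_fun setT ((fun t => l * t + h) : R -> measurableTypeR R).
Proof. by apply: measurable_funD => //; apply: measurable_funM. Qed.

Lemma lebesgue_measure_affine l h D : 0 < l -> measurable D ->
  (leb D = l%:E * leb ((fun t => (l * t + h)%R) @^-1` D))%E.
Proof.
move=> l0 mD; have mphi := measurable_affine l h.
pose phi : R -> measurableTypeR R := fun t => l * t + h.
pose M : {measure set (measurableTypeR R) -> \bar R} :=
  mscale (NngNum (ltW l0)) (pushforward leb phi).
rewrite -[RHS]/(M mphi D).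
apply: lebesgue_measure_unique => // _ [[a b]] _ <-.
rewrite /M /= /mscale /= /pushforward.
have -> : phi @^-1` `]a, b]%classic = `](a - h) / l, (b - h) / l]%classic.
  apply/seteqP; split=> t /=; rewrite !in_itv /= /phi ltr_pdivrMr // ler_pdivlMr //
    (mulrC t) ltrBlDr lerBrDr //.
rewrite !lebesgue_measure_itv/= !lte_fin ltr_pM2r ?invr_gt0 // ltrD2r.
case: ifP => ab; last by rewrite mule0.
by rewrite -!EFinD -EFinM; congr _%:E; field; rewrite gt_eqF.
Qed.

Lemma ge0_integral_affine l h D (F : R -> \bar R) : 0 < l -> measurable D ->
  measurable_fun D F -> (forall t, D t -> 0 <= F t)%E ->
  (\int[leb]_(t in D) F t =
   l%:E * \int[leb]_(t in (fun t => (l * t + h)%R) @^-1` D) F (l * t + h)%R)%E.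
Proof.
move=> l0 mD mF F0; have mphi := measurable_affine l h.
pose phi : R -> measurableTypeR R := fun t => l * t + h.
have inF0 : {in D, forall y, 0 <= F y}%E by move=> y /set_mem /F0.
have /= <- := @ge0_integral_pushforward _ _ (measurableTypeR R) (measurableTypeR R) R phi mphi
  (@lebesgue_measure R) D F mD mF inF0.
pose M : {measure set (measurableTypeR R) -> \bar R} := pushforward leb phi.
have /= <- := @ge0_integral_mscale _ (measurableTypeR R) R (M mphi) D mD
  (NngNum (ltW l0)) F mF F0.
by apply: eq_measure_integral => X mX _; exact: lebesgue_measure_affine.
Qed.

Lemma shift_affine h : shift h = (fun t => 1 * t + h).
Proof. by apply/funext => t; rewrite mul1r. Qed.

Lemma measurable_fun_affine d (T : measurableType d) l h D (F : R -> T) :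
  measurable D -> measurable_fun D F ->
  measurable_fun ((fun t => l * t + h) @^-1` D) (fun t => F (l * t + h)).
Proof.
move=> mD mF; have mphi := measurable_affine l h.
apply: (@measurable_comp _ _ _ _ _ _ D F _ (fun t => l * t + h)) => //.
- by move=> _ [t /= Dt <-].
- exact: measurable_funS mphi.
Qed.

Lemma measurable_preimage_shift h D : measurable D -> measurable (shift h @^-1` D).
Proof.
by move=> mD; rewrite shift_affine -[X in measurable X]setTI; exact: (measurable_affine 1 h).
Qed.

Lemma measurable_fun_shift d (T : measurableType d) h D (F : R -> T) :
  measurable D -> measurable_fun D F -> measurable_fun (shift h @^-1` D) (F \o shift h).
Proof. by move=> mD mF; rewrite shift_affine; exact: measurable_fun_affine. Qed.

Lemma ge0_integral_shift h D (F : R -> \bar R) : measurable D -> measurable_fun D F ->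
  (forall t, D t -> 0 <= F t)%E ->
  (\int[leb]_(t in D) F t = \int[leb]_(t in shift h @^-1` D) F (shift h t))%E.
Proof.
by move=> mD mF F0; rewrite shift_affine (ge0_integral_affine h ltr01 mD mF F0) mul1e.
Qed.

Lemma integral_shift h D (F : R -> \bar R) : measurable D -> measurable_fun D F ->
  (\int[leb]_(t in D) F t = \int[leb]_(t in shift h @^-1` D) F (shift h t))%E.
Proof.
move=> mD mF; rewrite integralE [RHS]integralE; congr (_ - _)%E.
- rewrite (ge0_integral_shift h mD (measurable_funepos mF)) //.
  by apply: eq_integral => t _; rewrite !funeposE.
- rewrite (ge0_integral_shift h mD (measurable_funeneg mF)) //.
  by apply: eq_integral => t _; rewrite !funenegE.
Qed.

Lemma integrable_shift h D (F : R -> \bar R) : measurable D ->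
  leb.-integrable D F -> leb.-integrable (shift h @^-1` D) (F \o shift h).
Proof.
move=> mD /integrableP[mF iF]; apply/integrableP.
split; first exact: measurable_fun_shift.
by rewrite -(integral_shift h (F := fun t => `|F t|%E)) //; exact: measurableT_comp.
Qed.

End AffineChangeOfVariables.

Section HalfLine.
Variable R : realType.
Local Notation leb := (@lebesgue_measure R).
Implicit Types (r : R -> R) (h t : R).

Lemma RplusE : @Rplus R = `[0, +oo[%classic.
Proof. by apply/seteqP; split=> s /=; rewrite in_itv /= andbT. Qed.

Lemma measurable_Rplus : measurable (@Rplus R).
Proof. by rewrite RplusE; exact: measurable_itv. Qed.

Lemma sub_itv_Rplus (b : itv_bound R) : [set` Interval (BLeft 0) b] `<=` @Rplus R.
Proof. by move=> s /=; rewrite in_itv => /andP[]. Qed.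

Lemma measurable_fun_RplusW (b : itv_bound R) r : measurable_fun (@Rplus R) r ->
  measurable_fun [set` Interval (BLeft 0) b] r.
Proof. by apply: measurable_funS; [exact: measurable_Rplus|exact: sub_itv_Rplus]. Qed.

Lemma Rplus_setU h : 0 <= h -> @Rplus R = `[0, h]%classic `|` `]h, +oo[%classic.
Proof.
move=> h0; apply/seteqP; split=> t; rewrite /Rplus /= !in_itv /= andbT.
  by move=> t0; case: (leP t h); [left; rewrite t0|right].
by case=> [/andP[]//|/ltW]; exact: le_trans.
Qed.

Lemma sub_gt_Rplus h : 0 <= h -> `]h, +oo[%classic `<=` @Rplus R.
Proof. by move=> h0 t; rewrite /= in_itv /= andbT => /ltW; exact: le_trans. Qed.

Lemma preimage_shift_ge h : shift h @^-1` `[h, +oo[ = @Rplus R.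
Proof. by apply/seteqP; split=> t /=; rewrite in_itv /= andbT /shift lerDr. Qed.

Lemma measurable_shift_Rplus d (T : measurableType d) h (F : R -> T) : 0 <= h ->
  measurable_fun (@Rplus R) F -> measurable_fun (@Rplus R) (F \o shift h).
Proof.
move=> h0 mF; rewrite -(preimage_shift_ge h); apply: measurable_fun_shift => //.
apply: measurable_funS mF => [|t]; first exact: measurable_Rplus.
by rewrite /= in_itv /= andbT; exact: le_trans.
Qed.

Lemma eq_integral_gt0 r r' : measurable_fun (@Rplus R) r -> measurable_fun (@Rplus R) r' ->
  (forall t, 0 < t -> r t = r' t) ->
  (\int[leb]_(t in @Rplus R) (r t)%:E = \int[leb]_(t in @Rplus R) (r' t)%:E)%E.
Proof.
move=> mr mr' rr'; have S := sub_gt_Rplus (lexx 0).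
rewrite RplusE -!integral_itv_obnd_cbnd.
- by apply: eq_integral => t; rewrite inE /= in_itv /= andbT => t0; rewrite rr'.
- by apply/measurable_EFinP; apply: measurable_funS mr' => //; exact: measurable_Rplus.
- by apply/measurable_EFinP; apply: measurable_funS mr => //; exact: measurable_Rplus.
Qed.

Lemma ge0_integral_split r h : 0 <= h ->
  measurable_fun (@Rplus R) r -> (forall t, 0 <= t -> 0 <= r t) ->
  (\int[leb]_(t in @Rplus R) (r t)%:E =
   \int[leb]_(t in `[0%R, h]) (r t)%:E + \int[leb]_(t in @Rplus R) (r (shift h t))%:E)%E.
Proof.
move=> h0 mr r0; have mR := measurable_Rplus.
have mrE : measurable_fun (@Rplus R) (EFin \o r) by exact/measurable_EFinP.
rewrite [in LHS](Rplus_setU h0) ge0_integral_setU //; first last.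
- apply/disj_setPS => t [] /=; rewrite !in_itv /= andbT ltNge.
  by move=> /andP[_ ->].
- by rewrite -Rplus_setU // => t t0; rewrite lee_fin r0.
- by rewrite -Rplus_setU.
congr (_ + _)%E; rewrite integral_itv_obnd_cbnd; last first.
  by apply: measurable_funS mrE => //; exact: sub_gt_Rplus.
rewrite (integral_shift h) ?preimage_shift_ge //.
by apply: measurable_funS mrE => // t /=; rewrite in_itv /= andbT; exact: le_trans.
Qed.

Lemma integral_itv0_cst (c h : R) : 0 <= h ->
  (\int[leb]_(t in `[0%R, h]) c%:E = (c * h)%:E)%E.
Proof.
move=> h0; rewrite integral_cst //= lebesgue_measure_itv /= lte_fin.
by case: ltgtP h0 => // [_|<-] _; rewrite ?sube0 // mule0 mulr0.
Qed.

End HalfLine.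

Section MeasurableComposition.
Variable R : realType.

Definition grid_cell (m k : nat) (c : 'rV[int]_m) : set 'rV[R]_m :=
  [set x | forall i, (c ord0 i)%:~R <= k.+1%:R * x ord0 i < (c ord0 i)%:~R + 1].

Definition grid_index (m k : nat) (x : 'rV[R]_m) : 'rV[int]_m :=
  \row_i Num.floor (k.+1%:R * x ord0 i).

Lemma measurable_preimage_grid_cell m k (c : 'rV[int]_m) (D : set R) (x : R -> 'rV[R]_m) :
  measurable D -> borel_vec D x -> measurable (D `&` x @^-1` grid_cell k c).
Proof.
move=> mD mx.
have -> : D `&` x @^-1` grid_cell k c = D `&` \bigcap_(i in [set: 'I_m])
    (D `&` (fun t => k.+1%:R * x t ord0 i) @^-1` `[(c ord0 i)%:~R, (c ord0 i)%:~R + 1[%classic).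
  apply/seteqP; split=> t [Dt] /= xt; split=> // i.
    by move=> _; split=> //=; rewrite in_itv /=; exact: xt.
  by have [_ /=] := xt i I; rewrite in_itv.
apply: measurableI => //; apply: fin_bigcap_measurable => // i _.
exact: (measurable_funM (measurable_cst _) (mx i)).
Qed.

Lemma grid_cell_index m k (x : 'rV[R]_m) : grid_cell k (grid_index k x) x.
Proof. by move=> i; rewrite mxE; have := floor_itv (k.+1%:R * x ord0 i); rewrite intrD. Qed.

Lemma grid_cell_ball m k (c : 'rV[int]_m) (x y : 'rV[R]_m) (e : R) :
  k.+1%:R^-1 <= e -> grid_cell k c x -> grid_cell k c y -> ball x e y.
Proof.
move=> ke cx cy; split; first by apply: lt_le_trans ke; rewrite invr_gt0 ltr0n.
move=> i j; rewrite ord1 /ball /= /ball_; apply: lt_le_trans ke.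
rewrite -[X in _ < X]mul1r ltr_pdivlMr ?ltr0n // mulrC.
rewrite -[k.+1%:R]ger0_norm ?ler0n // -normrM ltr_norml.
move: (cx j) (cy j) => /andP[c1 c2] /andP[c3 c4]; apply/andP; split; nra.
Qed.

Section Preimage.
Variables (n p q : nat) (D : set R).
Variables (y : R -> 'rV[R]_n) (a : R -> 'rV[R]_p) (b : R -> 'rV[R]_q).
Hypotheses (mD : measurable D).
Hypotheses (my : borel_vec D y) (ma : borel_vec D a) (mb : borel_vec D b).

(* An open set is the union of the countably many products of grid cells that it contains. *)
Lemma measurable_preimage_open (W : set ('rV[R]_n * 'rV[R]_p * 'rV[R]_q)) : open W ->
  measurable (D `&` [set t | W (y t, a t, b t)]).
Proof.
move=> oW.
pose C (i : nat * 'rV[int]_n * 'rV[int]_p * 'rV[int]_q) :=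
  grid_cell i.1.1.1 i.1.1.2 `*` grid_cell i.1.1.1 i.1.2 `*` grid_cell i.1.1.1 i.2.
have -> : D `&` [set t | W (y t, a t, b t)] = \bigcup_(i in [set i | C i `<=` W])
    ((D `&` y @^-1` grid_cell i.1.1.1 i.1.1.2) `&`
     ((D `&` a @^-1` grid_cell i.1.1.1 i.1.2) `&`
      (D `&` b @^-1` grid_cell i.1.1.1 i.2))).
  apply/seteqP; split=> t; last first.
    by move=> [i CW [[Dt yt] [[_ at_] [_ bt]]]]; split=> //; exact: CW.
  move=> [Dt Wt]; have := oW; rewrite openE => /(_ _ Wt)/nbhs_ballP[e /= e0 eW].
  have [k ke] : exists k : nat, k.+1%:R^-1 < e.
    by exists (Num.truncn e^-1); rewrite invf_plt ?posrE // truncnS_gt.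
  exists (k, grid_index k (y t), grid_index k (a t), grid_index k (b t)) => /=.
    move=> [[y' a'] b'] [[/= yy' aa'] bb']; apply: eW; split; first split=> /=;
      by apply: (grid_cell_ball (ltW ke) (grid_cell_index _ _)).
  by do 2 (split; first by split=> //; exact: grid_cell_index);
    split=> //; exact: grid_cell_index.
rewrite bigcup_mkcond; apply: countable_bigcupT_measurable => [|i]; first exact: countableP.
case: ifP => // _; apply: measurableI; first exact: measurable_preimage_grid_cell.
by apply: measurableI; exact: measurable_preimage_grid_cell.
Qed.

Lemma measurable_fun_comp_continuous (K : set ('rV[R]_n * 'rV[R]_p * 'rV[R]_q))
    (F : 'rV[R]_n * 'rV[R]_p * 'rV[R]_q -> R) :
  {within K, continuous F} -> (forall t, D t -> K (y t, a t, b t)) ->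
  measurable_fun D (fun t => F (y t, a t, b t)).
Proof.
move=> cF DK _; apply: (measurability _ (RGenOpens.measurableE R)) => //.
move=> _ [_ [r [s ->] <-]].
have ors : open `]r, s[%classic by exact: interval_open.
have /continuousP/(_ _ ors)/open_subspaceP[W oW WE] := cF.
have WF t : D t -> W (y t, a t, b t) <-> `]r, s[%classic (F (y t, a t, b t)).
  move=> /DK Kt; split=> Wt.
    by have [] : (F @^-1` `]r, s[ `&` K) (y t, a t, b t) by rewrite -WE.
  by have [] : (W `&` K) (y t, a t, b t) by rewrite WE.
rewrite (_ : _ `&` _ = D `&` [set t | W (y t, a t, b t)]); first exact: measurable_preimage_open.
by apply/seteqP; split=> t [Dt Ht]; split=> //; apply/WF.
Qed.

End Preimage.
End MeasurableComposition.

(** * Caratheodory differential equations *)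

Section ExpWeightedIntegrals.
Variable R : realType.
Local Notation leb := (@lebesgue_measure R).
Implicit Types (G : R -> R) (c k t : R).

Lemma integral_expR k t : k != 0 -> 0 <= t ->
  (\int[leb]_(s in `[0%R, t]) (expR (k * s))%:E = (k^-1 * (expR (k * t) - 1))%:E)%E.
Proof.
move=> k0; rewrite le_eqVlt => /predU1P[<-|t0].
  by rewrite set_itv1 integral_set1 mulr0 expR0 subrr mulr0.
have dF (x : R) : is_derive x (1:R) (fun s => k^-1 * expR (k * s)) (expR (k * x)).
  by apply: is_derive_eq; rewrite /GRing.scale /= mulr1 mulrCA mulVf ?mulr1.
have cE : continuous (fun s : R => expR (k * s)).
  by move=> x; apply: continuous_comp; [exact: mulrl_continuous|exact: continuous_expR].
have cF : continuous (fun s : R => k^-1 * expR (k * s)).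
  by move=> x; apply: cvgMl_tmp; exact: cE.
rewrite (@continuous_FTC2 _ _ (fun s => k^-1 * expR (k * s))) //.
- by rewrite mulr0 expR0 -EFinB mulrBr.
- exact: continuous_subspaceT.
- split; first by move=> x _; have [] := dF x.
  + by apply: cvg_at_right_filter; exact: cF.
  + by apply: cvg_at_left_filter; exact: cF.
- by move=> x _; rewrite derive1E; have [_ ->] := dF x.
Qed.

Lemma integral_norm_le_expR G c k t : 0 < k -> 0 <= c -> 0 <= t ->
  measurable_fun `[0, t] G -> (forall s, 0 < s <= t -> `|G s| <= c * expR (k * s)) ->
  (\int[leb]_(s in `[0%R, t]) `|G s|%:E <= (c / k * expR (k * t))%:E)%E.
Proof.
move=> k0 c0 t0 mG Gc.
have mE D : measurable_fun D (EFin \o (fun s : R => c * expR (k * s))).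
  apply/measurable_EFinP/measurable_funM => //.
  by apply: measurableT_comp => //; exact: mulrl_measurable.
apply: (@le_trans _ _ (\int[leb]_(s in `[0%R, t]) (c * expR (k * s))%:E)%E); last first.
  under eq_integral do rewrite EFinM.
  rewrite ge0_integralZl_EFin //; last first.
    by apply/measurable_EFinP/measurableT_comp => //; exact: mulrl_measurable.
  rewrite integral_expR ?gt_eqF // -EFinM lee_fin mulrA ler_wpM2l ?gerBl //.
  by rewrite divr_ge0 // ltW.
have mG' : measurable_fun `]0, t] (EFin \o (fun s => `|G s|)).
  apply/measurable_EFinP/measurableT_comp => //; apply: measurable_funS mG => //.
  exact: subset_itv_oc_cc.
rewrite -!(@integral_itv_obnd_cbnd R 0 (BRight t)) //.
by apply: ge0_le_integral => //; exact: mE.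
Qed.

Lemma integrable_le_expR G c k t : 0 < k -> 0 <= c -> 0 <= t ->
  measurable_fun `[0, t] G -> (forall s, 0 < s <= t -> `|G s| <= c * expR (k * s)) ->
  leb.-integrable `[0, t] (EFin \o G).
Proof.
move=> k0 c0 t0 mG Gc; apply/integrableP; split; first exact/measurable_EFinP.
by apply: le_lt_trans (integral_norm_le_expR k0 c0 t0 mG Gc) _; rewrite ltry.
Qed.

Lemma normr_Rintegral_le_expR G c k t : 0 < k -> 0 <= c -> 0 <= t ->
  measurable_fun `[0, t] G -> (forall s, 0 < s <= t -> `|G s| <= c * expR (k * s)) ->
  `|\int[leb]_(s in `[0, t]) G s| <= c / k * expR (k * t).
Proof.
move=> k0 c0 t0 mG Gc; have iG := integrable_le_expR k0 c0 t0 mG Gc.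
rewrite -lee_fin; apply: le_trans (integral_norm_le_expR k0 c0 t0 mG Gc).
rewrite EFin_normr_Rintegral //; apply: le_abse_integral => //.
exact/measurable_EFinP.
Qed.

Lemma measurable_Rintegral G :
  (forall t, 0 <= t -> leb.-integrable `[0, t] (EFin \o G)) ->
  measurable_fun (@Rplus R) (fun t => \int[leb]_(s in `[0, t]) G s).
Proof.
move=> iG.
have -> : @Rplus R = \bigcup_(N in [set: nat]) `[0, N%:R]%classic.
  apply/seteqP; split=> [t t0|t [N _] /=]; last by rewrite in_itv /= => /andP[].
  by exists (Num.truncn t).+1 => //=; rewrite in_itv /= [0 <= t]t0 ltW // truncnS_gt.
apply/measurable_fun_bigcup => [N|N]; first exact: measurable_itv.
apply: subspace_continuous_measurable_fun => //.
by apply: parameterized_integral_continuous; rewrite ?ler0n //; exact: iG.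
Qed.

End ExpWeightedIntegrals.

Section GeometricSequences.
Variable R : realType.

Lemma le0_geometric (x c : R) : (forall k, x <= c * (2^-1) ^+ k) -> x <= 0.
Proof.
move=> xc; have half1 : `|2^-1 : R| < 1 by rewrite ger0_norm // invf_lt1 // ltr1n.
have cv := cvg_geometric c half1.
by rewrite -(cvg_lim _ cv) //; apply: limr_ge; [exact: cvgP cv|exact: nearW].
Qed.

Variables (V : completeNormedModType R) (u : V^nat) (c : R).
Hypothesis u_incr : forall k, `|u k.+1 - u k| <= c * (2^-1) ^+ k.

Lemma geometric_increments_dist k m : `|u (k + m)%N - u k| <= 2 * c * (2^-1) ^+ k.
Proof.
have c0 : 0 <= c by have := u_incr 0; rewrite expr0 mulr1; exact: le_trans.
elim: m k => [|m IH] k; first by rewrite addn0 subrr normr0 !mulr_ge0 // exprn_ge0.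
rewrite addnS -addSn; apply: le_trans (ler_distD (u k.+1) _ _) _.
apply: le_trans (lerD (IH k.+1) (u_incr k)) _.
by rewrite exprS; lra.
Qed.

Lemma geometric_increments_cvg : cvgn u.
Proof.
apply/cauchy_cvgP/cauchy_exP => e e0.
have [k ke] : exists k, 2 * c * (2^-1) ^+ k < e.
  apply: contrapT => /forallNP ke; suff : e <= 0 by rewrite leNgt e0.
  by apply: (@le0_geometric _ (2 * c)) => k; rewrite leNgt; apply/negP.
exists (u k); exists k => // m /= km; rewrite -ball_normE /= distrC -(subnKC km).
exact: le_lt_trans (geometric_increments_dist _ _) ke.
Qed.

Lemma geometric_increments_lim k : `|limn u - u k| <= 2 * c * (2^-1) ^+ k.
Proof.
apply/ler_addgt0Pr => e e0; have /cvgrPdist_lt/(_ e e0)[N _ uN] := geometric_increments_cvg.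
rewrite [leRHS]addrC; apply: le_trans (ler_distD (u (k + N)%N) _ _) (lerD _ _).
  by apply/ltW/uN; exact: leq_addl.
exact: geometric_increments_dist.
Qed.

End GeometricSequences.

HB.instance Definition _ (R : realType) m n := Complete.on 'M[R]_(m, n).

Section VectorIntegral.
Variables (R : realType) (n : nat).
Local Notation leb := (@lebesgue_measure R).
Implicit Types (F G : R -> 'rV[R]_n) (c k t h : R).

Lemma coord_le_norm (x : 'rV[R]_n) i : `|x ord0 i| <= `|x|.
Proof.
rewrite [leRHS]/Num.Def.normr /= mx_normrE; apply/bigmax_geP; right => /=.
by exists (ord0, i).
Qed.

Lemma norm_le_coord (x : 'rV[R]_n) c : 0 <= c -> (forall i, `|x ord0 i| <= c) -> `|x| <= c.
Proof.
move=> c0 xc; rewrite [leLHS]/Num.Def.normr /= mx_normrE; apply/bigmax_leP.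
by split=> // -[j i] _ /=; rewrite ord1.
Qed.

Definition integrable_vec t F :=
  forall i, leb.-integrable `[0, t] (EFin \o (fun s => F s ord0 i)).

Definition integral_vec t F : 'rV[R]_n := \row_i \int[leb]_(s in `[0, t]) F s ord0 i.

Lemma integral_vecB t F G : integrable_vec t F -> integrable_vec t G ->
  integral_vec t (fun s => F s - G s) = integral_vec t F - integral_vec t G.
Proof.
move=> iF iG; apply/rowP => i; rewrite !mxE -RintegralB //.
by apply: eq_Rintegral => s _; rewrite !mxE.
Qed.

Lemma integral_vec_bounded t F : integrable_vec t F ->
  exists2 D, 0 <= D & forall s, 0 <= s <= t -> `|integral_vec s F| <= D.
Proof.
move=> iF; exists (\sum_i \int[leb]_(s in `[0, t]) `|F s ord0 i|).
  by apply: sumr_ge0 => i _; exact: Rintegral_ge0.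
move=> s /andP[s0 st]; apply: norm_le_coord => [|i].
  by apply: sumr_ge0 => i _; exact: Rintegral_ge0.
have sub : `[0, s] `<=` `[0, t] by apply: subset_itvl; rewrite bnd_simp.
have iFs : leb.-integrable `[0, s] (EFin \o (fun s => F s ord0 i)).
  exact: integrableS (iF i).
rewrite mxE (bigD1 i) //= ler_wpDr //.
  by apply: sumr_ge0 => j _; exact: Rintegral_ge0.
apply: le_trans (le_normr_Rintegral _ iFs) _ => //.
rewrite /Rintegral fine_le //.
- exact: integrable_fin_num (integrable_norm iFs).
- exact: integrable_fin_num (integrable_norm (iF i)).
- apply: ge0_subset_integral => //.
  by have /integrableP[] := integrable_norm (iF i).
Qed.

Lemma measurable_integral_vec F : (forall t, 0 <= t -> integrable_vec t F) ->
  borel_vec (@Rplus R) (fun t => integral_vec t F).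
Proof.
move=> iF i; under eq_fun do rewrite mxE.
by apply: measurable_Rintegral => t t0; exact: iF.
Qed.

Lemma preimage_shift_itv h t : shift h @^-1` `[h, t + h] = `[0, t]%classic.
Proof. by apply/seteqP; split=> s /=; rewrite !in_itv /= /shift lerDr lerD2r. Qed.

Lemma integrable_vec_shift h t F : 0 <= h -> 0 <= t ->
  integrable_vec (t + h) F -> integrable_vec t (F \o shift h).
Proof.
move=> h0 t0 iF i.
rewrite -(preimage_shift_itv h).
apply: (integrable_shift h (F := EFin \o (fun s => F s ord0 i))) => //.
by apply: integrableS (iF i) => //; apply: subset_itvr; rewrite bnd_simp.
Qed.

Lemma integral_vec_shift h t F : 0 <= h -> 0 <= t -> integrable_vec (t + h) F ->
  integral_vec t (F \o shift h) = integral_vec (t + h) F - integral_vec h F.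
Proof.
move=> h0 t0 iF; apply/rowP => i; rewrite !mxE.
have sub : `[h, t + h] `<=` `[0, t + h] by apply: subset_itvr; rewrite bnd_simp.
have iFh : leb.-integrable `[h, t + h] (EFin \o (fun s => F s ord0 i)).
  exact: integrableS (iF i).
rewrite Rintegral_itvB ?bnd_simp ?lerDr // Rintegral_itv_obnd_cbnd; last first.
  by apply: integrableS iFh => //; exact: subset_itv_oc_cc.
have /integrableP[mFh _] := iFh.
by rewrite /Rintegral [in RHS](integral_shift h) // preimage_shift_itv.
Qed.

Section ExpBounds.
Variables (F : R -> 'rV[R]_n) (c k t : R).
Hypotheses (k0 : 0 < k) (c0 : 0 <= c) (t0 : 0 <= t) (mF : borel_vec `[0, t] F).
Hypothesis Fc : forall s, 0 < s <= t -> `|F s| <= c * expR (k * s).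

Let coord_bound i s : 0 < s <= t -> `|F s ord0 i| <= c * expR (k * s).
Proof. by move=> /Fc; apply: le_trans; exact: coord_le_norm. Qed.

Lemma integrable_vec_le_expR : integrable_vec t F.
Proof. by move=> i; exact: integrable_le_expR k0 c0 t0 (mF i) (@coord_bound i). Qed.

Lemma norm_integral_vec_le_expR : `|integral_vec t F| <= c / k * expR (k * t).
Proof.
apply: norm_le_coord => [|i]; first by rewrite mulr_ge0 ?expR_ge0 // divr_ge0 // ltW.
rewrite mxE; exact: normr_Rintegral_le_expR k0 c0 t0 (mF i) (@coord_bound i).
Qed.

End ExpBounds.

(* Bielecki's weight [expR (2 * L * t)] makes the integral operator a contraction on the whole
   half-line. *)
Lemma integral_vec_contract (L d t : R) F G : 0 < L -> 0 <= d -> 0 <= t ->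
  integrable_vec t F -> integrable_vec t G ->
  (forall s, 0 < s <= t -> `|F s - G s| <= L * (d * expR (2 * L * s))) ->
  `|integral_vec t F - integral_vec t G| <= d / 2 * expR (2 * L * t).
Proof.
move=> L0 d0 t0 iF iG FG; rewrite -integral_vecB //.
have -> : d / 2 = L * d / (2 * L) by field; rewrite gt_eqF.
apply: norm_integral_vec_le_expR; rewrite ?mulr_gt0 ?mulr_ge0 // ?ltW //.
- move=> i; rewrite (_ : (fun s => _) = (fun s => F s ord0 i - G s ord0 i)); last first.
    by apply/funext => s; rewrite !mxE.
  apply: measurable_funB.
  + by have /integrableP[/measurable_EFinP] := iF i.
  + by have /integrableP[/measurable_EFinP] := iG i.
- by move=> s /FG; rewrite mulrA.
Qed.

End VectorIntegral.

Section Caratheodory.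
Variables (R : realType) (n : nat).
Implicit Types (H : R -> 'rV[R]_n -> 'rV[R]_n) (y z : R -> 'rV[R]_n).

Definition solution_on (T : R) H (x0 : 'rV[R]_n) y := forall t : R, 0 <= t <= T ->
  integrable_vec t (fun s => H s (y s)) /\ integral_vec t (fun s => H s (y s)) = y t - x0.

Lemma solution_on_shift H x0 y (h T : R) : 0 <= h -> solution_on (T + h) H x0 y ->
  solution_on T (fun s => H (s + h)) (y h) (y \o shift h).
Proof.
move=> h0 Sy t /andP[t0 tT].
have [|iF Fth] := Sy (t + h); first by rewrite addr_ge0 //= lerD2r.
have [|_ Fh] := Sy h; first by rewrite h0 /= lerDr (le_trans t0).
pose F s := H s (y s).
split; first exact: (@integrable_vec_shift _ _ h t F).
by rewrite (@integral_vec_shift _ _ h t F) // Fth Fh opprB addrA subrK.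
Qed.

Lemma expR_weight_ge1 (L t : R) : 0 < L -> 0 <= t -> 1 <= expR (2 * L * t).
Proof. by move=> L0 t0; rewrite -expR0 ler_expR !mulr_ge0 // ltW. Qed.

Lemma solution_on_unique (L T : R) H H' x0 y z : 0 < L ->
  (forall (s : R) x x', 0 < s <= T -> `|H s x - H s x'| <= L * `|x - x'|) ->
  (forall (s : R) x, 0 < s <= T -> H s x = H' s x) ->
  solution_on T H x0 y -> solution_on T H' x0 z -> forall t : R, 0 <= t <= T -> y t = z t.
Proof.
move=> L0 lipH HH' Sy Sz t0 t0T; have T0 : 0 <= T by case/andP: t0T => /le_trans; apply.
pose F s := H s (y s); pose G s := H' s (z s).
have TT : 0 <= T <= T by rewrite T0 lexx.
have [D D0 FD] := integral_vec_bounded (Sy T TT).1.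
have [E E0 GE] := integral_vec_bounded (Sz T TT).1.
have yz t : 0 <= t <= T -> y t - z t = integral_vec t F - integral_vec t G.
  by move=> tT; rewrite (Sy t tT).2 (Sz t tT).2 opprB addrA subrK.
have dist k t : 0 <= t <= T -> `|y t - z t| <= (D + E) * (2^-1) ^+ k * expR (2 * L * t).
  elim: k t => [|k IH] t tT; have /andP[t_ge0 tT'] := tT; rewrite yz //.
    rewrite expr0 mulr1; apply: le_trans (ler_normB _ _) _.
    apply: le_trans (lerD (FD t tT) (GE t tT)) _.
    by rewrite ler_peMr ?addr_ge0 // expR_weight_ge1.
  rewrite exprSr mulrA.
  apply: integral_vec_contract (Sy t tT).1 (Sz t tT).1 _; rewrite ?mulr_ge0 ?addr_ge0 ?exprn_ge0 //.
  move=> s /andP[s0 st]; have sT : 0 < s <= T by rewrite s0 (le_trans st).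
  rewrite /G -HH' //; apply: le_trans (lipH _ _ _ sT) _; rewrite ler_pM2l // IH //.
  by rewrite (ltW s0) (le_trans st).
apply/eqP; rewrite -subr_eq0 -normr_le0.
apply: (@le0_geometric _ _ ((D + E) * expR (2 * L * t0))) => k.
by rewrite mulrAC; exact: dist.
Qed.

Section Picard.
Variables (L M : R) (H : R -> 'rV[R]_n -> 'rV[R]_n) (x0 : 'rV[R]_n).
Hypothesis L0 : 0 < L.
Hypothesis lipH : forall (s : R) x x', 0 <= s -> `|H s x - H s x'| <= L * `|x - x'|.
Hypothesis boundH : forall s : R, 0 <= s -> `|H s x0| <= M.
Hypothesis borelH : forall y, borel_vec (@Rplus R) y ->
  borel_vec (@Rplus R) (fun s => H s (y s)).

Definition picard y (t : R) : 'rV[R]_n := x0 + integral_vec t (fun s => H s (y s)).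

Definition tempered y := borel_vec (@Rplus R) y /\
  exists2 K, 0 <= K & forall t : R, 0 <= t -> `|y t - x0| <= K * expR (2 * L * t).

Let L20 : 0 < 2 * L. Proof. by rewrite mulr_gt0. Qed.

Lemma tempered_drift y : tempered y -> exists2 K, 0 <= K &
  forall s : R, 0 <= s -> `|H s (y s)| <= K * expR (2 * L * s).
Proof.
move=> [_ [K K0 yK]]; have M0 : 0 <= M by exact: le_trans (boundH (lexx 0)).
exists (M + L * K); first by rewrite addr_ge0 // mulr_ge0 // ltW.
move=> s s0; rewrite -(subrK (H s x0) (H s (y s))); apply: le_trans (ler_normD _ _) _.
rewrite addrC mulrDl lerD //.
  by rewrite (le_trans (boundH s0)) // ler_peMr // expR_weight_ge1.
by apply: le_trans (lipH _ _ s0) _; rewrite -[leRHS]mulrA ler_pM2l // yK.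
Qed.

Lemma tempered_integrable y t : tempered y -> 0 <= t -> integrable_vec t (fun s => H s (y s)).
Proof.
move=> ty t0; have [K K0 hK] := tempered_drift ty.
apply: (integrable_vec_le_expR L20 K0 t0) => [i|s /andP[/ltW s0 _]]; last exact: hK.
exact: measurable_fun_RplusW (borelH ty.1 i).
Qed.

Lemma picard_tempered y : tempered y -> tempered (picard y).
Proof.
move=> ty; split=> [i|].
  under eq_fun do rewrite mxE; apply: measurable_funD => //.
  by apply: measurable_integral_vec => t; exact: tempered_integrable.
have [K K0 hK] := tempered_drift ty.
exists (K / (2 * L)); first by rewrite divr_ge0 // ltW.
move=> t t0; rewrite addrAC subrr add0r.
apply: (norm_integral_vec_le_expR L20 K0 t0) => [i|s /andP[/ltW s0 _]]; last exact: hK.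
exact: measurable_fun_RplusW (borelH ty.1 i).
Qed.

Lemma picard_contract y z d : tempered y -> tempered z -> 0 <= d ->
  (forall t : R, 0 <= t -> `|y t - z t| <= d * expR (2 * L * t)) ->
  forall t : R, 0 <= t -> `|picard y t - picard z t| <= d / 2 * expR (2 * L * t).
Proof.
move=> ty tz d0 yz t t0; rewrite [- (_ + _)]opprD addrACA subrr add0r.
apply: integral_vec_contract => // [||s /andP[/ltW s0 _]]; try exact: tempered_integrable.
by apply: le_trans (lipH _ _ s0) _; rewrite ler_pM2l // yz.
Qed.

Lemma tempered_lim (Y : nat -> R -> 'rV[R]_n) (K : R) : (forall k, tempered (Y k)) ->
  (forall t, 0 <= t -> cvgn (Y ^~ t)) ->
  (forall t, 0 <= t -> `|limn (Y ^~ t) - Y 0 t| <= K * expR (2 * L * t)) ->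
  tempered (fun t => limn (Y ^~ t)).
Proof.
move=> tY cY YK; have [_ [K0 K00 Y0K]] := tY 0; split=> [i|].
  apply: (measurable_fun_cvg (h := fun k t => Y k t ord0 i)) => [k|t t0].
    exact: (tY k).1.
  exact: cvg_comp (cY t t0) (@coord_continuous _ _ _ ord0 i _).
exists (`|K| + K0) => [|t t0]; first by rewrite addr_ge0.
apply: le_trans (ler_distD (Y 0 t) _ _) _; rewrite mulrDl lerD ?Y0K //.
by rewrite (le_trans (YK t t0)) // ler_wpM2r ?expR_ge0 // ler_norm.
Qed.

Lemma picard_fixpoint : exists2 y, tempered y & forall t : R, 0 <= t -> picard y t = y t.
Proof.
pose Y k := iter k picard (fun=> x0).
have tY k : tempered (Y k).
  elim: k => [|k IH]; last exact: picard_tempered.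
  split; first by move=> i; exact: measurable_cst.
  by exists 0 => // t _; rewrite subrr normr0 mul0r.
have [_ [K K0 Y1]] := tY 1.
have incr t k : 0 <= t -> `|Y k.+1 t - Y k t| <= K * expR (2 * L * t) * (2^-1) ^+ k.
  move=> t0; rewrite mulrAC; elim: k t t0 => [|k IH] t t0; first by rewrite expr0 mulr1 Y1.
  rewrite exprSr mulrA; apply: (@picard_contract (Y k.+1) (Y k)) => //.
  by rewrite mulr_ge0 // exprn_ge0.
pose y t := limn (Y ^~ t).
have yY t k : 0 <= t -> `|y t - Y k t| <= 2 * K * (2^-1) ^+ k * expR (2 * L * t).
  move=> t0; rewrite mulrAC -[2 * K * _]mulrA.
  by apply: (geometric_increments_lim (u := Y ^~ t)) => j; exact: incr.
have ty : tempered y.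
  apply: (@tempered_lim _ (2 * K)) => // t t0.
    by apply: (geometric_increments_cvg (u := Y ^~ t)) => j; exact: incr.
  by have := yY t 0 t0; rewrite expr0 mulr1.
exists y => // t t0; apply/eqP; rewrite -subr_eq0 -normr_le0.
apply: (@le0_geometric _ _ (2 * K * expR (2 * L * t))) => k.
have d0 : 0 <= 2 * K * 2^-1 ^+ k by rewrite !mulr_ge0 // exprn_ge0.
apply: le_trans (ler_distD (Y k.+1 t) _ _) _; rewrite [`|Y _ _ - _|]distrC.
apply: le_trans (lerD (picard_contract ty (tY k) d0 (yY ^~ k) t0) (yY t k.+1 t0)) _.
by rewrite exprS; lra.
Qed.

Lemma caratheodory_exists : exists y, forall T : R, solution_on T H x0 y.
Proof.
have [y ty py] := picard_fixpoint; exists y => T t /andP[t0 _].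
split; first exact: tempered_integrable.
by rewrite -[in RHS]py // addrAC subrr add0r.
Qed.

End Picard.

End Caratheodory.

(** * Weights *)

Section Pasting.
Variable R : realType.

Definition paste T (h : R) (a a' : R -> T) : R -> T :=
  fun t => if t <= h then a t else a' (center h t).

Lemma paste_le T (h : R) (a a' : R -> T) t : t <= h -> paste h a a' t = a t.
Proof. by rewrite /paste => ->. Qed.

Lemma paste_gt T (h : R) (a a' : R -> T) t : 0 < t -> paste h a a' (shift h t) = a' t.
Proof. by move=> t0; rewrite /paste /shift gerDr leNgt t0 /= addrK. Qed.

Lemma measurable_paste d (T : measurableType d) (h : R) (a a' : R -> T) : 0 <= h ->
  measurable_fun (@Rplus R) a -> measurable_fun (@Rplus R) a' ->
  measurable_fun (@Rplus R) (paste h a a').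
Proof.
move=> h0 ma ma'; have mR := @measurable_Rplus R.
rewrite (Rplus_setU h0); apply/measurable_funU => //; split.
  apply: (eq_measurable_fun a) => [t|]; first by rewrite inE /= in_itv => /andP[_ /paste_le].
  by apply: measurable_funS ma => //; exact: sub_itv_Rplus.
apply: (eq_measurable_fun (a' \o center h)) => [t|].
  by rewrite inE /= in_itv /= andbT /paste ltNge => /negbTE ->.
apply: measurable_funS (measurable_fun_shift (h := - h) mR ma').
  exact: measurable_preimage_shift.
by move=> t; rewrite /= in_itv /= andbT /Rplus /= /shift subr_ge0 => /ltW.
Qed.

End Pasting.

Section Weights.
Variable R : realType.
Local Notation leb := (@lebesgue_measure R).
Implicit Types (r : R -> R) (c h l : R) (D : set R).

Definition mass r : \bar R := (\int[leb]_(t in @Rplus R) (r t)%:E)%E.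

Definition L1dist D r r' : \bar R := (\int[leb]_(t in D) `|r t - r' t|%:E)%E.

Record weight r : Prop := Weight {
  weight_ge0 : forall t, 0 <= t -> 0 <= r t;
  measurable_weight : measurable_fun (@Rplus R) r;
  mass_lty : (mass r < +oo)%E }.

Lemma eq_mass r r' : (forall t, 0 <= t -> r t = r' t) -> mass r = mass r'.
Proof. by move=> rr'; apply: eq_integral => t; rewrite inE => t0; rewrite rr'. Qed.

Lemma eq_weight r r' : (forall t, 0 <= t -> r t = r' t) -> weight r -> weight r'.
Proof.
move=> rr' [r0 mr fr]; split=> [t t0||]; first by rewrite -rr' ?r0.
  by apply: eq_measurable_fun mr => t; rewrite inE; exact: rr'.
by rewrite -(eq_mass rr').
Qed.

Lemma mass_ge0 r : weight r -> (0 <= mass r)%E.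
Proof. by move=> wr; apply: integral_ge0 => t t0; rewrite lee_fin weight_ge0. Qed.

Lemma mass_fin_num r : weight r -> mass r \is a fin_num.
Proof. by move=> wr; rewrite ge0_fin_numE ?mass_ge0 // mass_lty. Qed.

Lemma mass0 : mass (fun=> 0) = 0%E.
Proof. exact: integral0_eq. Qed.

Lemma weight0 : weight (fun=> 0).
Proof. by split=> //; rewrite mass0. Qed.

Lemma density_weight r : density r -> weight r.
Proof. by move=> [r0 [mr mass1]]; split=> //; rewrite /mass mass1 ltry. Qed.

Lemma mass_density r : density r -> (mass r = 1)%E.
Proof. by move=> [_ []]. Qed.

Lemma mass_split r h : 0 <= h -> weight r ->
  (mass r = \int[leb]_(t in `[0%R, h]) (r t)%:E + mass (r \o shift h))%E.
Proof. by move=> h0 [r0 mr _]; exact: ge0_integral_split. Qed.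

Lemma mass_shift_le r h : 0 <= h -> weight r -> (mass (r \o shift h) <= mass r)%E.
Proof.
move=> h0 wr; rewrite (mass_split h0 wr) leeDr //; apply: integral_ge0 => t.
by move=> /sub_itv_Rplus t0; rewrite lee_fin weight_ge0.
Qed.

Lemma weight_shift r h : 0 <= h -> weight r -> weight (r \o shift h).
Proof.
move=> h0 wr; split=> [t t0||]; first by rewrite /= weight_ge0 // /shift addr_ge0.
  by apply: measurable_shift_Rplus => //; exact: measurable_weight.
by apply: le_lt_trans (mass_shift_le h0 wr) _; exact: mass_lty.
Qed.

Lemma massZ r c : 0 <= c -> weight r -> (mass (fun t => c * r t)%R = c%:E * mass r)%E.
Proof.
move=> c0 wr; rewrite /mass; under eq_integral do rewrite EFinM.
rewrite ge0_integralZl_EFin //; first exact: measurable_Rplus.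
- by move=> t t0; rewrite lee_fin weight_ge0.
- by apply/measurable_EFinP; exact: measurable_weight.
Qed.

Lemma weightZ r c : 0 <= c -> weight r -> weight (fun t => c * r t).
Proof.
move=> c0 wr; split=> [t t0||]; first by rewrite mulr_ge0 ?weight_ge0.
  by apply: measurable_funM => //; exact: measurable_weight.
by rewrite massZ // lte_mul_pinfty // mass_lty.
Qed.

Lemma measurable_scale r l : 0 < l -> measurable_fun (@Rplus R) r ->
  measurable_fun (@Rplus R) (fun t => r (l * t)).
Proof.
move=> l0 mr; have D : (fun t => l * t + 0) @^-1` @Rplus R = @Rplus R.
  by apply/seteqP; split=> t; rewrite /Rplus /= addr0 pmulr_rge0.
have := measurable_fun_affine (l := l) (h := 0) (@measurable_Rplus R) mr.
by rewrite D; under eq_fun do rewrite addr0.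
Qed.

Lemma ge0_mass_rho_scale r l : 0 < l -> measurable_fun (@Rplus R) r ->
  (forall t, 0 <= t -> 0 <= r t) -> mass (rho_scale r l) = mass r.
Proof.
move=> l0 mr r0; have mR := @measurable_Rplus R.
have D : (fun t => l * t + 0) @^-1` @Rplus R = @Rplus R.
  by apply/seteqP; split=> t; rewrite /Rplus /= addr0 pmulr_rge0.
rewrite [RHS](@ge0_integral_affine R l 0) //; last exact/measurable_EFinP.
rewrite D -ge0_integralZl_EFin ?(ltW l0) //; first last.
- by apply/measurable_EFinP; under eq_fun do rewrite addr0; exact: measurable_scale.
- by move=> t t0; rewrite lee_fin addr0 r0 // mulr_ge0 // ltW.
- by apply: eq_integral => t _; rewrite addr0 -EFinM.
Qed.

Lemma mass_rho_scale r l : 0 < l -> weight r -> mass (rho_scale r l) = mass r.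
Proof. by move=> l0 [r0 mr _]; exact: ge0_mass_rho_scale. Qed.

Lemma weight_rho_scale r l : 0 < l -> weight r -> weight (rho_scale r l).
Proof.
move=> l0 wr; split=> [t t0||]; last by rewrite mass_rho_scale // mass_lty.
  by rewrite mulr_ge0 ?(ltW l0) // weight_ge0 // mulr_ge0 // ltW.
by apply: measurable_funM => //; apply: measurable_scale => //; exact: measurable_weight.
Qed.

Lemma rho_scale_shift r l h t : 0 < l ->
  rho_scale r l (shift (h / l) t) = rho_scale (r \o shift h) l t.
Proof. by move=> l0; rewrite /rho_scale /= /shift mulrDr mulrCA mulfV ?mulr1 ?gt_eqF. Qed.

Lemma measurable_dist D r r' : measurable_fun D r -> measurable_fun D r' ->
  measurable_fun D (fun t => `|r t - r' t|).
Proof. by move=> mr mr'; apply: measurableT_comp => //; exact: measurable_funB. Qed.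

Lemma L1distC D r r' : L1dist D r r' = L1dist D r' r.
Proof. by apply: eq_integral => t _; rewrite distrC. Qed.

Lemma L1dist_triangle D r r' r'' : measurable D -> measurable_fun D r ->
  measurable_fun D r' -> measurable_fun D r'' ->
  (L1dist D r r'' <= L1dist D r r' + L1dist D r' r'')%E.
Proof.
move=> mD mr mr' mr''; rewrite /L1dist -ge0_integralD //; first last.
- by apply/measurable_EFinP; exact: measurable_dist.
- by apply/measurable_EFinP; exact: measurable_dist.
apply: ge0_le_integral => //; first by apply/measurable_EFinP; exact: measurable_dist.
  by apply: emeasurable_funD; apply/measurable_EFinP; exact: measurable_dist.
by move=> t _; rewrite -EFinD lee_fin ler_distD.
Qed.

Lemma L1dist_itv_le r r' c h : 0 <= h -> measurable_fun `[0, h] r -> measurable_fun `[0, h] r' ->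
  (forall t, 0 < t <= h -> `|r t - r' t| <= c) -> (L1dist `[0%R, h] r r' <= (c * h)%:E)%E.
Proof.
move=> h0 mr mr' rc; rewrite -integral_itv0_cst // /L1dist.
have md : measurable_fun `]0, h] (fun t => (`|r t - r' t|)%:E).
  apply/measurable_EFinP; apply: measurable_funS (measurable_dist mr mr') => //.
  exact: subset_itv_oc_cc.
by rewrite -!(@integral_itv_obnd_cbnd R 0 (BRight h)) //; exact: ge0_le_integral.
Qed.

Lemma L1dist_split r r' h : 0 <= h -> weight r -> weight r' ->
  L1dist (@Rplus R) r r' =
  (L1dist `[0%R, h] r r' + L1dist (@Rplus R) (r \o shift h) (r' \o shift h))%E.
Proof.
move=> h0 wr wr'; apply: ge0_integral_split => //.
by apply: measurable_dist; exact: measurable_weight.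
Qed.

Lemma mass_le_L1dist r r' : weight r -> weight r' ->
  (mass r <= mass r' + L1dist (@Rplus R) r r')%E.
Proof.
move=> [r0 mr _] [r0' mr' _]; have mR := @measurable_Rplus R.
rewrite -ge0_integralD //; first last.
- by apply/measurable_EFinP; exact: measurable_dist.
- exact/measurable_EFinP.
apply: ge0_le_integral => //; try exact/measurable_EFinP.
  by apply: emeasurable_funD; apply/measurable_EFinP => //; exact: measurable_dist.
by move=> t t0; rewrite -EFinD lee_fin -lerBlDl ler_norm.
Qed.

Lemma dist_mass_le r r' c : weight r -> weight r' -> (L1dist (@Rplus R) r r' <= c%:E)%E ->
  `|fine (mass r) - fine (mass r')| <= c.
Proof.
have mass_le s s' : weight s -> weight s' -> (L1dist (@Rplus R) s s' <= c%:E)%E ->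
    fine (mass s) <= fine (mass s') + c.
  move=> ws ws' ss'; rewrite -lee_fin EFinD !fineK ?mass_fin_num //.
  by apply: le_trans (mass_le_L1dist ws ws') _; exact: leeD2l.
move=> wr wr' rr'; have := mass_le _ _ wr wr' rr'; rewrite L1distC in rr'.
by have := mass_le _ _ wr' wr rr'; rewrite ler_norml; lra.
Qed.

Lemma L1dist_rho_scale r r' l : 0 < l -> weight r -> weight r' ->
  L1dist (@Rplus R) (rho_scale r l) (rho_scale r' l) = L1dist (@Rplus R) r r'.
Proof.
move=> l0 wr wr'; rewrite -[RHS](@ge0_mass_rho_scale (fun t => `|r t - r' t|) l) //.
  apply: eq_integral => t _; rewrite /rho_scale -mulrBr normrM.
  by rewrite (ger0_norm (ltW l0)).
by apply: measurable_dist; exact: measurable_weight.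
Qed.

Lemma L1dist_gt0_eq r r' : measurable_fun (@Rplus R) r -> measurable_fun (@Rplus R) r' ->
  (forall t, 0 < t -> r t = r' t) -> L1dist (@Rplus R) r r' = 0%E.
Proof.
move=> mr mr' rr'.
rewrite /L1dist (eq_integral_gt0 (r' := fun=> 0)) //; first exact: integral0_eq.
  exact: measurable_dist.
by move=> t t0; rewrite rr' // subrr normr0.
Qed.

End Weights.

Section StepWeights.
Variable R : realType.
Implicit Types (r : R -> R) (c d l t T : R).

Lemma paste_cst_ge0 r c d t : 0 <= c -> (forall s, 0 <= s -> 0 <= r s) ->
  0 <= paste d (fun=> c) r t.
Proof.
move=> c0 r0; rewrite /paste; case: (leP t d) => // td; apply: r0.
by rewrite /shift subr_ge0 ltW.
Qed.

Lemma mass_paste_cst r c d : 0 <= c -> 0 <= d -> weight r ->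
  (mass (paste d (fun=> c) r) = (c * d)%:E + mass r)%E.
Proof.
move=> c0 d0 [r0 mr _]; have mp : measurable_fun (@Rplus R) (paste d (fun=> c) r).
  exact: measurable_paste.
rewrite /mass (ge0_integral_split d0 mp); last first.
  by move=> t _; exact: paste_cst_ge0.
congr (_ + _)%E.
  rewrite -integral_itv0_cst //; apply: eq_integral => t.
  by rewrite inE /= in_itv => /andP[_ /paste_le ->].
apply: eq_integral_gt0 => // [|t]; first exact: measurable_shift_Rplus.
exact: paste_gt.
Qed.

Lemma weight_paste_cst r c d : 0 <= c -> 0 <= d -> weight r -> weight (paste d (fun=> c) r).
Proof.
move=> c0 d0 wr; split=> [t _||].
- by apply: paste_cst_ge0 => //; exact: weight_ge0.
- by apply: measurable_paste => //; exact: measurable_weight.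
- by rewrite mass_paste_cst // lte_add_pinfty ?ltry ?mass_lty.
Qed.

Definition steps d (cs : seq R) : R -> R := foldr (fun c => paste d (fun=> c)) (fun=> 0) cs.

Lemma weight_steps d cs : 0 <= d -> all (fun c => 0 < c) cs -> weight (steps d cs).
Proof.
move=> d0; elim: cs => [|c cs IH] /= => [_|/andP[/ltW c0 cs0]]; first exact: weight0.
exact/weight_paste_cst/IH.
Qed.

Definition box c T : R -> R := paste T (fun=> c) (fun=> 0).

Lemma box_le c T t : t <= T -> box c T t = c. Proof. exact: paste_le. Qed.

Lemma boxE c T t : box c T t = if t <= T then c else 0. Proof. by []. Qed.

Lemma weight_box c T : 0 <= c -> 0 <= T -> weight (box c T).
Proof. by move=> c0 T0; apply: weight_paste_cst => //; exact: weight0. Qed.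

Lemma mass_box c T : 0 <= c -> 0 <= T -> mass (box c T) = (c * T)%:E.
Proof.
by move=> c0 T0; rewrite mass_paste_cst ?mass0 ?adde0 //; exact: weight0.
Qed.

Lemma rho_scale_box c T l : 0 < l -> rho_scale (box c T) l = box (l * c) (T / l).
Proof.
move=> l0; apply/funext => t; rewrite /rho_scale !boxE ler_pdivlMr // mulrC.
by rewrite (mulrC t); case: ifP; rewrite ?mul0r // mulrC.
Qed.

Lemma box_shift c T d t : box c (T + d) (shift d t) = box c T t.
Proof. by rewrite !boxE /shift lerD2r. Qed.

Lemma varpi_box T t : 0 <= t -> varpi T t = box T^-1 T t.
Proof. by move=> t0; rewrite /varpi t0. Qed.

Lemma weight_varpi T : 0 <= T -> weight (varpi T).
Proof.
move=> T0; apply: (@eq_weight _ (box T^-1 T)) => [t t0|]; first by rewrite varpi_box.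
by apply: weight_box; rewrite ?invr_ge0.
Qed.

Lemma mass_varpi T : 0 < T -> (mass (varpi T) = 1)%E.
Proof.
by move=> T0; rewrite (eq_mass (@varpi_box T)) mass_box ?invr_ge0 ?ltW // mulVf ?gt_eqF.
Qed.

Lemma varpi_rho_scale T t : 0 < T -> 0 <= t -> varpi T t = rho_scale (varpi 1) T^-1 t.
Proof.
move=> T0 t0; rewrite /rho_scale /varpi t0 /= invr1 (mulrC T^-1 t) ler_pdivrMr // mul1r.
by rewrite mulr_ge0 ?invr_ge0 ?(ltW T0) //=; case: ifP; rewrite ?mulr1 ?mulr0.
Qed.

End StepWeights.

Section SwitchingValue.
Variables (R : realType) (X : choiceType) (Om : set X) (V : (R -> R) -> X -> R).
Implicit Types (r : R -> R) (h c I D : R).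

Record switching_value : Prop := SwitchingValue {
  switching_value_ge0 : forall r x, weight r -> 0 <= V r x;
  switching_valueZ : forall r x c, 0 < c -> weight r -> V (fun t => c * r t) x = c * V r x;
  switching_value_lipschitz : forall r r' x I, weight r -> weight r' ->
    (L1dist (@Rplus R) r r' <= I%:E)%E -> V r x <= V r' x + I;
  switching_value_switch : forall r r' x h I D, weight r -> weight r' -> Om x -> 0 < h ->
    (L1dist `[0%R, h] r r' <= I%:E)%E ->
    (forall z, Om z -> V (r \o shift h) z <= V (r' \o shift h) z + D) ->
    V r x <= V r' x + (I + D) }.

End SwitchingValue.

(** * Trajectories, payoffs and values *)

Section Controls.
Variables (R : realType) (k : nat) (K : set 'rV[R]_k).
Implicit Types (a : R -> 'rV[R]_k) (h : R).

Lemma control_cst c : K c -> control K (fun=> c).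
Proof.
move=> Kc; split=> //; split; first by move=> i; exact: measurable_cst.
by exists `|c|.
Qed.

Lemma control_shift a h : 0 <= h -> control K a -> control K (a \o shift h).
Proof.
move=> h0 [Ka [ma [M aM]]]; split=> [t t0|]; first by apply: Ka; rewrite /shift addr_ge0.
split; first by move=> i; exact: (measurable_shift_Rplus h0 (ma i)).
by exists M => t t0; apply: aM; rewrite /shift addr_ge0.
Qed.

Lemma control_paste a a' h : 0 <= h -> control K a -> control K a' -> control K (paste h a a').
Proof.
move=> h0 [Ka [ma [M aM]]] [Ka' [ma' [M' aM']]].
have center_ge0 t : h < t -> 0 <= center h t by rewrite /shift subr_ge0 => /ltW.
split=> [t t0|].
  by rewrite /paste; case: (leP t h) => [_|/center_ge0]; [exact: Ka|exact: Ka'].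
split=> [i|].
  rewrite (_ : (fun t => _) = paste h (fun t => a t ord0 i) (fun t => a' t ord0 i)).
    exact: measurable_paste.
  by apply/funext => t; rewrite /paste; case: ifP.
exists (Num.max M M') => t t0; rewrite /paste le_max; case: (leP t h) => [_|/center_ge0 ht].
  by rewrite aM.
by rewrite aM' ?orbT.
Qed.

End Controls.

Section ControlledSystem.
Variables (R : realType) (n p q : nat) (A : set 'rV[R]_p) (B : set 'rV[R]_q).
Variables (f : 'rV[R]_n -> 'rV[R]_p -> 'rV[R]_q -> 'rV[R]_n)
          (g : 'rV[R]_n -> 'rV[R]_p -> 'rV[R]_q -> R) (L : R).
Local Notation leb := (@lebesgue_measure R).
Implicit Types (r : R -> R) (x : 'rV[R]_n) (a : R -> 'rV[R]_p) (b : R -> 'rV[R]_q).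
Implicit Types (t h c e : R).
Hypotheses (cA : compact A) (cB : compact B).
Hypothesis cf : {within [set z : 'rV[R]_n * 'rV[R]_p * 'rV[R]_q | A z.1.2 /\ B z.2],
  continuous (fun z => f z.1.1 z.1.2 z.2)}.
Hypothesis L0 : 0 < L.
Hypothesis lip_f : forall x y u v, A u -> B v -> `|f x u v - f y u v| <= L * `|x - y|.

Definition admissible a b := control A a /\ control B b.

Lemma admissible_shift h a b : 0 <= h -> admissible a b ->
  admissible (a \o shift h) (b \o shift h).
Proof. by move=> h0 [Ca Cb]; split; exact: control_shift. Qed.

Lemma admissibleAB a b t : admissible a b -> 0 <= t -> A (a t) /\ B (b t).
Proof. by move=> [[Aa _] [Bb _]] t0; split; [exact: Aa|exact: Bb]. Qed.

Lemma drift_bounded x : exists M : R, forall u v, A u -> B v -> `|f x u v| <= M.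
Proof.
have cK : compact ([set x] `*` A `*` B).
  by apply: compact_setX => //; apply: compact_setX => //; exact: compact_set1.
have sub : [set x] `*` A `*` B `<=` [set z | A z.1.2 /\ B z.2].
  by move=> [[x' u] v] [[_ Au] Bv].
have /compact_bounded [M [_ HM]] := continuous_compact (continuous_subspaceW sub cf) cK.
exists (M + 1) => u v Au Bv; apply: (HM (M + 1)); first by rewrite ltrDl.
by exists (x, u, v).
Qed.

Lemma borel_drift a b y : admissible a b -> borel_vec (@Rplus R) y ->
  borel_vec (@Rplus R) (fun s => f (y s) (a s) (b s)).
Proof.
move=> ab my i; have [[_ [ma _]] [_ [mb _]]] := ab.
have cfi : {within [set z : 'rV[R]_n * 'rV[R]_p * 'rV[R]_q | A z.1.2 /\ B z.2],
    continuous (fun z => f z.1.1 z.1.2 z.2 ord0 i)}.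
  apply: (@within_continuous_comp _ _ _ _ _ (fun x : 'rV[R]_n => x ord0 i) _ cf).
  by move=> x _; exact: coord_continuous.
apply: (measurable_fun_comp_continuous (@measurable_Rplus R) my ma mb cfi) => t.
exact: admissibleAB.
Qed.

Lemma is_solutionP x a b y : is_solution f x a b y <->
  forall T, solution_on T (fun s x => f x (a s) (b s)) x y.
Proof.
have seg t : [set s : R | 0 <= s <= t] = `[0, t]%classic.
  by apply/seteqP; split=> s /=; rewrite in_itv.
split=> [Sy T t /andP[t0 _]|Sy t t0 i].
  split=> [i|]; first by rewrite -seg; have [] := Sy t t0 i.
  by apply/rowP => i; rewrite !mxE /Rintegral -seg; have [_ ->] := Sy t t0 i.
have [|iy /rowP/(_ i)] := Sy t t; first by rewrite t0 lexx.
rewrite !mxE seg => <-; split; first exact: iy.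
by rewrite fineK //; exact: integrable_fin_num (iy i).
Qed.

Lemma traj_solution x a b T : admissible a b ->
  solution_on T (fun s x => f x (a s) (b s)) x (traj f x a b).
Proof.
move=> ab; move: T; apply/is_solutionP; rewrite /traj; apply: epsilon_spec.
have [M fM] := drift_bounded x.
have [|||y Sy] := @caratheodory_exists R n L M (fun s x => f x (a s) (b s)) x L0.
- by move=> s x1 x2 /(admissibleAB ab)[]; exact: lip_f.
- by move=> s /(admissibleAB ab)[]; exact: fM.
- by move=> y; exact: borel_drift.
by exists y; apply/is_solutionP.
Qed.

Lemma traj_unique x a b a' b' T : admissible a b -> admissible a' b' ->
  (forall s, 0 < s <= T -> a s = a' s /\ b s = b' s) ->
  forall t, 0 <= t <= T -> traj f x a b t = traj f x a' b' t.
Proof.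
move=> ab ab' eq_ab; apply: (solution_on_unique L0 _ _ (traj_solution x ab)
  (traj_solution x ab')) => [s x1 x2 /andP[/ltW s0 _]|s x1 /eq_ab[-> ->]] //.
by have [] := admissibleAB ab s0; exact: lip_f.
Qed.

Lemma traj_shift x a b h t : admissible a b -> 0 <= h -> 0 <= t ->
  traj f x a b (shift h t) = traj f (traj f x a b h) (a \o shift h) (b \o shift h) t.
Proof.
move=> ab h0 t0; have abh := admissible_shift h0 ab; have tt : 0 <= t <= t by rewrite t0 lexx.
have Sh := solution_on_shift h0 (traj_solution x (T := t + h) ab).
apply: (solution_on_unique L0 _ _ Sh (traj_solution _ abh)) tt => //.
by move=> s x1 x2 /andP[/ltW s0 _]; have [] := admissibleAB abh s0; exact: lip_f.
Qed.

Lemma borel_traj x a b : admissible a b -> borel_vec (@Rplus R) (traj f x a b).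
Proof.
move=> ab i; pose F s := f (traj f x a b s) (a s) (b s).
have Sx t : 0 <= t -> integrable_vec t F /\ integral_vec t F = traj f x a b t - x.
  by move=> t0; apply: (traj_solution x (T := t) ab); rewrite t0 lexx.
apply: (eq_measurable_fun (fun t => x ord0 i + integral_vec t F ord0 i)).
  by move=> t; rewrite inE => /Sx[_ ->]; rewrite !mxE addrCA subrr addr0.
apply: measurable_funD => //; apply: measurable_integral_vec.
by move=> t /Sx[].
Qed.

Hypothesis cg : {within [set z : 'rV[R]_n * 'rV[R]_p * 'rV[R]_q | A z.1.2 /\ B z.2],
  continuous (fun z => g z.1.1 z.1.2 z.2)}.
Hypothesis g01 : forall x u v, A u -> B v -> 0 <= g x u v <= 1.

Definition running x a b t := g (traj f x a b t) (a t) (b t).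

Definition payoff_until h r x a b : \bar R :=
  (\int[leb]_(t in `[0%R, h]) (r t * running x a b t)%:E)%E.

Lemma running01 x a b t : admissible a b -> 0 <= t -> 0 <= running x a b t <= 1.
Proof. by move=> ab t0; have [] := admissibleAB ab t0; exact: g01. Qed.

Lemma measurable_reward r x a b : weight r -> admissible a b ->
  measurable_fun (@Rplus R) (fun t => r t * running x a b t).
Proof.
move=> wr ab; apply: measurable_funM; first exact: measurable_weight.
have [[_ [ma _]] [_ [mb _]]] := ab.
apply: (measurable_fun_comp_continuous (@measurable_Rplus R) (borel_traj x ab) ma mb cg).
by move=> t; exact: admissibleAB.
Qed.

Lemma reward_ge0 r x a b t : weight r -> admissible a b -> 0 <= t ->
  0 <= r t * running x a b t.
Proof.
by move=> wr ab t0; have /andP[g0 _] := running01 x ab t0; rewrite mulr_ge0 // weight_ge0.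
Qed.

Lemma payoff_ge0 r x a b : weight r -> admissible a b -> (0 <= payoff f g r x a b)%E.
Proof. by move=> wr ab; apply: integral_ge0 => t t0; rewrite lee_fin; exact: reward_ge0. Qed.

Lemma payoff_le_mass r x a b : weight r -> admissible a b ->
  (payoff f g r x a b <= mass r)%E.
Proof.
move=> wr ab; apply: ge0_le_integral; first exact: measurable_Rplus.
- by move=> t t0; rewrite lee_fin; exact: reward_ge0.
- by apply/measurable_EFinP; exact: measurable_reward.
- by apply/measurable_EFinP; exact: measurable_weight.
- move=> t t0; have /andP[_ g1] := running01 x ab t0.
  by rewrite lee_fin ler_piMr // weight_ge0.
Qed.

Lemma payoffZ r x a b c : 0 <= c -> weight r -> admissible a b ->
  payoff f g (fun t => c * r t) x a b = (c%:E * payoff f g r x a b)%E.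
Proof.
move=> c0 wr ab; rewrite /payoff -ge0_integralZl_EFin //.
- by apply: eq_integral => t _; rewrite -EFinM mulrA.
- exact: measurable_Rplus.
- by move=> t t0; rewrite lee_fin; exact: reward_ge0.
- by apply/measurable_EFinP; exact: measurable_reward.
Qed.

Lemma integral_reward_le (D : set R) r r' x a b : measurable D -> D `<=` @Rplus R ->
  weight r -> weight r' -> admissible a b ->
  (\int[leb]_(t in D) (r t * running x a b t)%:E <=
   \int[leb]_(t in D) (r' t * running x a b t)%:E + L1dist D r r')%E.
Proof.
move=> mD DR wr wr' ab.
have mS (F : R -> R) : measurable_fun (@Rplus R) F -> measurable_fun D (EFin \o F).
  move=> mF; apply/measurable_EFinP; apply: measurable_funS mF => //.
  exact: measurable_Rplus.
have mdist : measurable_fun D (EFin \o (fun t => `|r t - r' t|)).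
  by apply: mS; apply: measurable_dist; exact: measurable_weight.
have mr' := mS _ (measurable_reward x wr' ab).
rewrite -ge0_integralD //; last by move=> t /DR t0; rewrite lee_fin; exact: reward_ge0.
apply: ge0_le_integral => //.
- by move=> t /DR t0; rewrite lee_fin; exact: reward_ge0.
- by apply: mS; exact: measurable_reward.
- exact: emeasurable_funD.
- move=> t /DR t0; rewrite -EFinD lee_fin; have /andP[g0 g1] := running01 x ab t0.
  rewrite -lerBlDl -mulrBl; apply: le_trans (ler_norm _) _.
  by rewrite normrM (ger0_norm g0) ler_piMr.
Qed.

Lemma payoff_split r x a b h : 0 <= h -> weight r -> admissible a b ->
  (payoff f g r x a b = payoff_until h r x a b +
   payoff f g (r \o shift h) (traj f x a b h) (a \o shift h) (b \o shift h))%E.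
Proof.
move=> h0 wr ab; rewrite [LHS](ge0_integral_split h0 (measurable_reward x wr ab)); last first.
  by move=> t t0; exact: reward_ge0.
by congr (_ + _)%E; apply: eq_integral => t; rewrite inE => t0; rewrite /running traj_shift.
Qed.

Lemma eq_payoff_until r x a b a' b' h : admissible a b -> admissible a' b' ->
  (forall t, 0 <= t <= h -> a t = a' t /\ b t = b' t) ->
  payoff_until h r x a b = payoff_until h r x a' b'.
Proof.
move=> ab ab' eq_ab; apply: eq_integral => t; rewrite inE /= in_itv => th.
have [at_ bt] := eq_ab t th; rewrite /running at_ bt.
rewrite (traj_unique x ab ab' (T := h)) // => s /andP[/ltW s0 sh].
by apply: eq_ab; rewrite s0.
Qed.

Lemma eq_payoff_gt0 r x a b a' b' : weight r -> admissible a b -> admissible a' b' ->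
  (forall t, 0 < t -> a t = a' t /\ b t = b' t) ->
  payoff f g r x a b = payoff f g r x a' b'.
Proof.
move=> wr ab ab' eq_ab; apply: eq_integral_gt0; try exact: measurable_reward.
move=> t t0; have [at_ bt] := eq_ab t t0.
rewrite /running at_ bt (traj_unique x ab ab' (T := t)) ?lexx ?ltW // => s /andP[s0 _].
exact: eq_ab.
Qed.

Lemma payoff_switch r x a b a1 b1 a2 b2 h : 0 <= h -> weight r ->
  admissible a b -> admissible a1 b1 -> admissible a2 b2 ->
  (forall t, 0 <= t <= h -> a t = a1 t /\ b t = b1 t) ->
  (forall t, 0 < t -> a (shift h t) = a2 t /\ b (shift h t) = b2 t) ->
  (payoff f g r x a b =
   payoff_until h r x a1 b1 + payoff f g (r \o shift h) (traj f x a1 b1 h) a2 b2)%E.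
Proof.
move=> h0 wr ab ab1 ab2 eq1 eq2; rewrite (payoff_split x h0 wr ab).
rewrite (eq_payoff_until r x ab ab1 eq1) (traj_unique x ab ab1 (T := h)) ?h0 ?lexx //.
  by rewrite (eq_payoff_gt0 _ _ (admissible_shift h0 ab) ab2 eq2) //; exact: weight_shift.
by move=> s /andP[/ltW s0 sh]; apply: eq1; rewrite s0.
Qed.

Hypotheses (A0 : A !=set0) (B0 : B !=set0).
Local Notation V := (value A B f g).

Definition ereal_value r x : \bar R :=
  ereal_inf [set ereal_sup [set payoff f g r x (al b) b | b in control B]
            | al in quasistrategy A B].

Lemma quasistrategy_admissible al b : quasistrategy A B al -> control B b ->
  admissible (al b) b.
Proof. by move=> [Cal _] Cb; split=> //; exact: Cal. Qed.

Lemma ereal_value_fin_num r x : weight r -> ereal_value r x \is a fin_num.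
Proof.
move=> wr; have [a0 Aa0] := A0; have [b0 /control_cst Cb0] := B0.
have Qa0 : quasistrategy A B (fun=> (fun=> a0)) by split=> // b _; exact: control_cst.
rewrite ge0_fin_numE; last first.
  apply: le_ereal_inf_tmp => _ [al Qal <-].
  apply: le_trans (payoff_ge0 x wr (quasistrategy_admissible Qal Cb0)) _.
  by apply: ereal_sup_ubound; exists (fun=> b0).
apply: le_lt_trans (mass_lty wr).
apply: le_trans (ereal_inf_lbound _) _; first by exists (fun=> (fun=> a0)).
by apply: ge_ereal_sup => _ [b Cb <-]; exact/payoff_le_mass/quasistrategy_admissible.
Qed.

Lemma EFin_value r x : weight r -> (V r x)%:E = ereal_value r x.
Proof. by move=> wr; rewrite fineK //; exact: ereal_value_fin_num. Qed.

Lemma value_approx r x e : weight r -> 0 < e ->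
  exists2 al, quasistrategy A B al &
    forall b, control B b -> (payoff f g r x (al b) b <= (V r x + e)%:E)%E.
Proof.
move=> wr e0; have [_ [al Qal <-] lt] := lb_ereal_inf_adherent e0 (ereal_value_fin_num x wr).
exists al => // b Cb; rewrite EFinD EFin_value //.
by apply: le_trans (ltW lt); apply: ereal_sup_ubound; exists b.
Qed.

Lemma value_le r x al c : weight r -> quasistrategy A B al ->
  (forall b, control B b -> (payoff f g r x (al b) b <= c%:E)%E) -> V r x <= c.
Proof.
move=> wr Qal alc; rewrite -lee_fin EFin_value //.
apply: le_trans (ereal_inf_lbound _) _; first by exists al.
by apply: ge_ereal_sup => _ [b Cb <-]; exact: alc.
Qed.

Lemma value_reply r x al e : weight r -> quasistrategy A B al -> 0 < e ->
  exists2 b, control B b & ((V r x)%:E <= payoff f g r x (al b) b + e%:E)%E.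
Proof.
move=> wr Qal e0; apply: contrapT => no_reply.
suff : V r x <= V r x - e by rewrite lerBrDr gerDl leNgt e0.
apply: (value_le wr Qal) => b Cb; rewrite leNgt; apply/negP => lt.
by apply: no_reply; exists b => //; rewrite -leeBlDr // -EFinB ltW.
Qed.

Lemma value_ge0 r x : weight r -> 0 <= V r x.
Proof.
move=> wr; apply/ler_addgt0Pr => e e0; have [al Qal alV] := value_approx x wr e0.
have [b0 /control_cst Cb] := B0; rewrite -lee_fin (le_trans _ (alV _ Cb)) //.
exact/payoff_ge0/quasistrategy_admissible.
Qed.

Lemma valueZ_le r x c : 0 < c -> weight r -> V (fun t => c * r t) x <= c * V r x.
Proof.
move=> c0 wr; have c0' := ltW c0; apply/ler_addgt0Pr => e e0.
have [al Qal alV] := value_approx x wr (divr_gt0 e0 c0).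
apply: (value_le (weightZ c0' wr) Qal) => b Cb.
rewrite payoffZ //; last exact: quasistrategy_admissible.
apply: le_trans (lee_wpmul2l _ (alV b Cb)) _; first by rewrite lee_fin.
by rewrite -EFinM lee_fin mulrDr (mulrC c (e / c)) divfK // gt_eqF.
Qed.

Lemma valueZ r x c : 0 < c -> weight r -> V (fun t => c * r t) x = c * V r x.
Proof.
move=> c0 wr; apply/eqP; rewrite eq_le valueZ_le //= -ler_pdivlMl //.
have ci0 : 0 < c^-1 by rewrite invr_gt0.
have := valueZ_le x ci0 (weightZ (ltW c0) wr).
suff -> : (fun t => c^-1 * (c * r t)) = r by [].
by apply/funext => t; rewrite mulKf // gt_eqF.
Qed.

Lemma value_lipschitz r r' x (I : R) : weight r -> weight r' ->
  (L1dist (@Rplus R) r r' <= I%:E)%E -> V r x <= V r' x + I.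
Proof.
move=> wr wr' rr'; apply/ler_addgt0Pr => e e0.
have [al Qal alV] := value_approx x wr' e0.
apply: (value_le wr Qal) => b Cb; have ab := quasistrategy_admissible Qal Cb.
apply: le_trans (integral_reward_le x (@measurable_Rplus R) (fun _ Dt => Dt) wr wr' ab) _.
by rewrite [V r' x + I + e]addrAC [leRHS]EFinD; exact: leeD (alV b Cb) rr'.
Qed.

Variable Om : set 'rV[R]_n.
Hypothesis invariant : forall x a b t, Om x -> control A a -> control B b -> 0 <= t ->
  Om (traj f x a b t).

(* A quasistrategy constrains replies only on segments [[0, t]] with [0 < t], so at time [h]
   itself the reply still has to be the one of [al]. *)
Lemma quasistrategy_switch x h al (sig : 'rV[R]_n -> (R -> 'rV[R]_q) -> R -> 'rV[R]_p) :
  Om x -> 0 < h -> quasistrategy A B al -> (forall z, Om z -> quasistrategy A B (sig z)) ->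
  quasistrategy A B
    (fun b => paste h (al b) (sig (traj f x (al b) b h) (b \o shift h))).
Proof.
move=> Ox h0 Qal Qsig; have h0' := ltW h0; have [Cal Nal] := Qal.
have Oz b : control B b -> Om (traj f x (al b) b h).
  by move=> Cb; apply: invariant => //; exact: Cal.
split=> [b Cb|b b' t Cb Cb' t0 bb' s /andP[s0 st]].
  apply: control_paste => //; first exact: Cal.
  by apply: (Qsig _ (Oz b Cb)).1; exact: control_shift.
rewrite /paste; case: (leP s h) => sh; first by apply: (Nal b b' t) => //; rewrite s0.
have ht : h < t by exact: lt_le_trans st.
have bb'h u : 0 <= u <= h -> b u = b' u.
  by move=> /andP[u0 uh]; apply: bb'; rewrite u0 (le_trans uh) // ltW.
have <- : traj f x (al b) b h = traj f x (al b') b' h.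
  apply: (traj_unique x _ _ (T := h)); rewrite ?h0' ?lexx //; try exact: quasistrategy_admissible.
  move=> u /andP[/ltW u0 uh]; have u0h : 0 <= u <= h by rewrite u0.
  by split; [exact: (Nal b b' h)|exact: bb'h].
apply: ((Qsig _ (Oz b Cb)).2 _ _ (t - h)); try exact: control_shift.
- by rewrite subr_gt0.
- by move=> u /andP[u0 ut]; apply: bb'; rewrite /shift addr_ge0 //= -lerBrDr.
- by rewrite /shift subr_ge0 (ltW sh) lerD2r.
Qed.

Lemma quasistrategy_continuation h al b : 0 < h -> quasistrategy A B al -> control B b ->
  quasistrategy A B (fun be => al (paste h b be) \o shift h).
Proof.
move=> h0 [Cal Nal] Cb; have h0' := ltW h0.
split=> [be Cbe|be be' t Cbe Cbe' t0 bebe' s /andP[s0 st]].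
  by apply: control_shift => //; apply: Cal; exact: control_paste.
apply: (Nal _ _ (t + h)); try exact: control_paste; first by rewrite addr_gt0.
  move=> u /andP[u0 ut]; rewrite /paste; case: (leP u h) => // hu.
  by apply: bebe'; rewrite /shift subr_ge0 (ltW hu) lerBlDr.
by rewrite /shift addr_ge0 //= lerD2r.
Qed.

Lemma dynamic_programming_le r x al c h : weight r -> Om x -> 0 < h -> quasistrategy A B al ->
  (forall b, control B b -> (payoff_until h r x (al b) b +
     (V (r \o shift h) (traj f x (al b) b h))%:E <= c%:E)%E) -> V r x <= c.
Proof.
move=> wr Ox h0 Qal alc; have h0' := ltW h0; apply/ler_addgt0Pr => e e0.
have wrh := weight_shift h0' wr.
have /choice[sig sigP] : forall z, exists al', Om z -> quasistrategy A B al' /\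
    forall b, control B b -> (payoff f g (r \o shift h) z (al' b) b <=
      (V (r \o shift h) z + e)%:E)%E.
  by move=> z; have [al' ? ?] := value_approx z wrh e0; exists al'.
have Qsw := quasistrategy_switch Ox h0 Qal (fun z Oz => (sigP z Oz).1).
apply: (value_le wr Qsw) => b Cb; have Cbh := control_shift h0' Cb.
have ab := quasistrategy_admissible Qal Cb; have [Cal _] := ab.
have [Qsig sigV] := sigP _ (invariant Ox Cal Cb h0').
rewrite (@payoff_switch r x _ b (al b) b
  (sig (traj f x (al b) b h) (b \o shift h)) (b \o shift h) h) //.
- rewrite EFinD; apply: le_trans (leeD2l _ (sigV _ Cbh)) _.
  by rewrite EFinD addeA leeD2r // alc.
- exact: quasistrategy_admissible Qsw Cb.
- exact: quasistrategy_admissible Qsig Cbh.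
- by move=> t /andP[_ th]; rewrite paste_le.
- by move=> t t0; rewrite paste_gt.
Qed.

Lemma dynamic_programming_ge r x al c h : weight r -> 0 < h -> quasistrategy A B al ->
  (forall b, control B b -> (payoff f g r x (al b) b <= c%:E)%E) ->
  forall b, control B b -> (payoff_until h r x (al b) b +
    (V (r \o shift h) (traj f x (al b) b h))%:E <= c%:E)%E.
Proof.
move=> wr h0 Qal alc b Cb; have h0' := ltW h0; have wrh := weight_shift h0' wr.
have Qc := quasistrategy_continuation h0 Qal Cb.
apply/lee_addgt0Pr => e e0; have [be Cbe beV] := value_reply (traj f x (al b) b h) wrh Qc e0.
set b' := paste h b be in beV *; have Cb' : control B b' by exact: control_paste.
suff switchE : payoff f g r x (al b') b' = (payoff_until h r x (al b) b +
    payoff f g (r \o shift h) (traj f x (al b) b h) (al b' \o shift h) be)%E.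
  by apply: le_trans (leeD2l _ beV) _; rewrite addeA leeD2r // -switchE alc.
apply: payoff_switch => //; try exact: quasistrategy_admissible.
- exact: quasistrategy_admissible Qc Cbe.
- move=> t /andP[t0 th]; rewrite /b' paste_le //; split=> //.
  apply: (Qal.2 _ _ h) => //; first by move=> s /andP[_ sh]; rewrite paste_le.
  by rewrite t0.
- by move=> t t0; rewrite /b' paste_gt.
Qed.

Lemma value_switch r r' x h (I D : R) : weight r -> weight r' -> Om x -> 0 < h ->
  (L1dist `[0%R, h] r r' <= I%:E)%E ->
  (forall z, Om z -> V (r \o shift h) z <= V (r' \o shift h) z + D) ->
  V r x <= V r' x + (I + D).
Proof.
move=> wr wr' Ox h0 rr' VD; apply/ler_addgt0Pr => e e0.
have [al Qal alV] := value_approx x wr' e0.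
apply: (dynamic_programming_le wr Ox h0 Qal) => b Cb.
have ab := quasistrategy_admissible Qal Cb; have [Cal _] := ab.
have Oz := invariant Ox Cal Cb (ltW h0).
have until_le : (payoff_until h r x (al b) b <= payoff_until h r' x (al b) b + I%:E)%E.
  apply: le_trans (integral_reward_le x _ (@sub_itv_Rplus R _) wr wr' ab) _ => //.
  exact: leeD2l.
have := dynamic_programming_ge wr' h0 Qal alV Cb.
move: (VD _ Oz); rewrite -lee_fin => tail_le total_le.
apply: le_trans (leeD until_le tail_le) _.
rewrite [X in (_ + X <= _)%E]EFinD addeACA -EFinD.
by rewrite [V r' x + _ + e]addrAC [leRHS]EFinD leeD2r.
Qed.

Lemma value_switching : switching_value Om V.
Proof.
split.
- exact: value_ge0.
- exact: valueZ.
- exact: value_lipschitz.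
- exact: value_switch.
Qed.

End ControlledSystem.

(** * Approximation by step functions *)

Section StepApproximation.
Variable R : realType.
Local Notation leb := (@lebesgue_measure R).
Implicit Types (r h : R -> R) (d e t : R).

Lemma steps_nth d cs i t : 0 < d -> i%:R * d < t <= i.+1%:R * d ->
  steps d cs t = nth 0 cs i.
Proof.
move=> d0; elim: cs i t => [|c cs IH] [|i] t /=; rewrite ?nth_nil // -natr1 mulrDl mul1r.
  by rewrite mul0r add0r => /andP[_ /paste_le].
rewrite -[i.+2%:R]natr1 mulrDl mul1r => /andP[it ti].
rewrite -(subrK d t) -[_ + d]/(shift d _) paste_gt; last first.
  by apply: le_lt_trans (_ : i%:R * d < _); [rewrite mulr_ge0 // ltW|rewrite ltrBrDr].
by apply: IH; rewrite ltrBrDr it lerBlDr.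
Qed.

Lemma grid_interval_exists d t : 0 < d -> 0 < t ->
  exists i : nat, i%:R * d < t <= i.+1%:R * d.
Proof.
move=> d0 t0; have ex : exists n : nat, t <= n.+1%:R * d.
  by exists (Num.truncn (t / d)); rewrite -ler_pdivrMr // ltW // truncnS_gt.
case: (ex_minnP ex) => -[|i] ti imin; [exists 0%N|exists i.+1]; rewrite ti andbT.
  by rewrite mul0r.
by rewrite ltNge; apply/negP => /imin; rewrite ltnn.
Qed.

Lemma steps_out d cs t : 0 < d -> (size cs)%:R * d < t -> steps d cs t = 0.
Proof.
move=> d0 szt; have t0 : 0 < t by apply: le_lt_trans szt; rewrite mulr_ge0 // ltW.
have [i /andP[it ti]] := grid_interval_exists d0 t0.
rewrite (steps_nth _ d0 (i := i)) ?it // nth_default // -ltnS -(ltr_nat R) -(ltr_pM2r d0).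
exact: lt_le_trans ti.
Qed.

Lemma continuous_segment_unif h (a b : R) e : continuous h -> 0 < e ->
  exists2 d, 0 < d & forall x y, a <= x <= b -> `|x - y| < d -> `|h x - h y| <= e.
Proof.
move=> ch e0; have /compact_near_coveringP cov := @segment_compact R a b.
have [|d /= d0 Hd] :=
    cov R (0^'+) (fun d x => forall y, `|x - y| < d -> `|h x - h y| <= e) _.
  move=> x _; have e20 : 0 < e / 2 by rewrite divr_gt0.
  have /cvgrPdist_lt/(_ _ e20)/nbhs_ballP[r /= r0 hr] := ch x.
  have r20 : 0 < r / 2 by rewrite divr_gt0.
  exists (ball x (r / 2), [set d : R | d < r / 2]) => /=.
    by split; [exact: nbhsx_ballx|exact: nbhs_right_lt].
  move=> [x' d] /= [xx' dr] y x'y; rewrite (splitr e).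
  apply: le_trans (ler_distD (h x) _ _) (lerD (ltW _) (ltW _)).
    by rewrite distrC; apply: hr; apply: le_ball xx'; lra.
  apply: hr; rewrite /ball /= in xx' *; rewrite (splitr r).
  by apply: le_lt_trans (ler_distD x' _ _) (ltrD xx' _); exact: lt_trans dr.
have d20 : 0 < d / 2 by rewrite divr_gt0.
exists (d / 2) => // x y xab xy.
apply: (Hd (d / 2) _ d20 x _ y xy) => /=; last by rewrite in_itv.
by rewrite sub0r normrN gtr0_norm // ltr_pdivrMr // mulr_natr mulr2n ltrDl.
Qed.

Lemma dist_max0_le (x y : R) : `|Num.max x 0 - Num.max y 0| <= `|x - y|.
Proof.
have := ler_norm (x - y); have := ler_norm (y - x); rewrite (distrC y x).
move: `|x - y| => m yx xy; rewrite ler_norml.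
by case: (leP x 0) => x0; case: (leP y 0) => y0; apply/andP; split; lra.
Qed.

Lemma continuous_steps_approx h (N e : R) : continuous h -> 0 < N -> 0 < e ->
  exists d cs, [/\ 0 < d, all (fun c => 0 < c) cs, (size cs)%:R * d = N &
    forall t, 0 < t <= N -> `|Num.max (h t) 0 - steps d cs t| <= e].
Proof.
move=> ch N0 e0; have e20 : 0 < e / 2 by rewrite divr_gt0.
have [d0 d00 hd0] := continuous_segment_unif 0 N ch e20.
pose K := (Num.truncn (N / d0)).+1; have K0 : 0 < K%:R :> R by rewrite ltr0n.
pose d := N / K%:R; have dpos : 0 < d by rewrite divr_gt0.
have dd0 : d < d0 by rewrite /d ltr_pdivrMr // mulrC -ltr_pdivrMr // truncnS_gt.
pose phi i := Num.max (h (i.+1%:R * d)) 0 + e / 2.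
have KdN : K%:R * d = N by rewrite /d mulrC divfK // gt_eqF.
exists d, (mkseq phi K); split=> //; last 2 first.
- by rewrite size_mkseq.
- move=> t tN; have /andP[t0 tleN] := tN; have [i /andP[it ti]] := grid_interval_exists dpos t0.
  have iK : (i < K)%N.
    by rewrite -(ltr_nat R) -(ltr_pM2r dpos) KdN (lt_le_trans it).
  rewrite (steps_nth _ dpos (i := i)) ?it // nth_mkseq // /phi opprD addrA.
  rewrite [leRHS]splitr; apply: le_trans (ler_normB _ _) _; rewrite (gtr0_norm e20) lerD2r.
  apply: le_trans (dist_max0_le _ _) (hd0 _ _ _ _); first by rewrite (ltW t0).
  apply: le_lt_trans dd0; rewrite ler_norml; move: it ti; rewrite -natr1 mulrDl mul1r.
  by move=> it ti; apply/andP; split; lra.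
- by apply/allP => c /mapP[i _ ->]; rewrite ltr_wpDl // le_max lexx orbT.
Qed.

Lemma weight_tail_small r e : weight r -> 0 < e ->
  exists2 N, 0 < N & (mass (r \o shift N) <= e%:E)%E.
Proof.
move=> wr e0; have mr := measurable_weight wr.
pose F (n : nat) : set R := `[0, n%:R]%classic.
have nd : nondecreasing_seq F.
  apply/nondecreasing_seqP => n; rewrite subsetEset.
  by apply: subset_itvl; rewrite bnd_simp ler_nat.
have r0 n t : F n t -> (0 <= (EFin \o r) t)%E.
  by move=> /sub_itv_Rplus t0; rewrite lee_fin weight_ge0.
have mrF n : measurable_fun (F n) (EFin \o r).
  by apply/measurable_EFinP; exact: measurable_fun_RplusW.
have UE : \bigcup_n F n = @Rplus R.
  apply/seteqP; split=> t; first by move=> [n _ /sub_itv_Rplus].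
  move=> t0; exists (Num.truncn t).+1 => //=; rewrite /F /= in_itv /= [0 <= t]t0 ltW //.
  exact: truncnS_gt.
have := ge0_nondecreasing_set_cvg_integral (mu := leb) nd (fun n => measurable_itv _) mrF r0.
rewrite UE -/(mass r) -(fineK (mass_fin_num wr)) => /fine_cvgP[[n1 _ fin]].
move=> /cvgrPdist_lt/(_ _ e0)[n2 _ close].
pose n := (maxn n1 n2).+1; have n0 : 0 <= n%:R :> R by [].
have /= fn := fin n (leq_trans (leq_maxl n1 n2) (leqnSn _)).
have /= := close n (leq_trans (leq_maxr n1 n2) (leqnSn _)).
have wt := weight_shift n0 wr; rewrite (mass_split n0 wr).
rewrite -(fineK fn) -(fineK (mass_fin_num wt)) /= addrAC subrr add0r => small.
exists n%:R => //; rewrite -(fineK (mass_fin_num wt)) lee_fin.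
exact: le_trans (ler_norm _) (ltW small).
Qed.

Lemma weight_continuous_approx r (N e : R) : weight r -> 0 <= N -> 0 < e ->
  exists2 h, continuous h & (L1dist `[0%R, N] r h <= e%:E)%E.
Proof.
move=> wr N0 e0; have mr := measurable_weight wr.
have iR : leb.-integrable (@Rplus R) (EFin \o r).
  apply/integrableP; split; first exact/measurable_EFinP.
  rewrite [ltLHS](@eq_mass _ (fun t => `|r t|) r) ?mass_lty // => t t0.
  by rewrite ger0_norm // weight_ge0.
have iN : leb.-integrable `[0, N] (EFin \o r).
  by apply: integrableS iR => //; [exact: measurable_Rplus|exact: sub_itv_Rplus].
have fN : (leb `[0%R, N]%classic < +oo)%E.
  by rewrite lebesgue_measure_itv /=; case: ifP; rewrite ltry.
have [h [ch _ /fine_cvgP[[n1 _ fin] /cvgrPdist_lt/(_ _ e0)[n2 _ close]]]] :=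
  approximation_continuous_integrable (measurable_itv _) fN iN.
have /= fn := fin _ (leq_maxl n1 n2); have /= := close _ (leq_maxr n1 n2).
rewrite sub0r normrN => small; exists (h (maxn n1 n2)); first exact: ch.
by rewrite /L1dist -(fineK fn) lee_fin ltW // (le_lt_trans (ler_norm _)).
Qed.

Lemma steps_dense r e : weight r -> 0 < e ->
  exists d cs, [/\ 0 < d, all (fun c => 0 < c) cs &
    (L1dist (@Rplus R) r (steps d cs) <= e%:E)%E].
Proof.
move=> wr e0; have e30 : 0 < e / 3 by rewrite divr_gt0.
have [N N0 tail] := weight_tail_small wr e30; have N0' := ltW N0.
have [h ch rh] := weight_continuous_approx wr N0' e30.
have [d [cs [d0 cs0 size_cs hcs]]] := continuous_steps_approx ch N0 (divr_gt0 e30 N0).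
exists d, cs; split=> //; have ws := weight_steps (ltW d0) cs0.
pose h0 t := Num.max (h t) 0.
have mh0 : measurable_fun `[0, N] h0.
  by apply: measurable_funTS; apply: measurable_maxr => //; exact: continuous_measurable_fun.
have mrN := measurable_fun_RplusW (b := BRight N) (measurable_weight wr).
have msN := measurable_fun_RplusW (b := BRight N) (measurable_weight ws).
have rh0 : (L1dist `[0%R, N] r h0 <= (e / 3)%:E)%E.
  apply: le_trans rh; apply: ge0_le_integral => //.
  - by apply/measurable_EFinP; exact: measurable_dist.
  - apply/measurable_EFinP; apply: measurable_dist => //.
    by apply: measurable_funTS; exact: continuous_measurable_fun.
  move=> t /sub_itv_Rplus t0; have rt0 := weight_ge0 wr t0; rewrite lee_fin.
  by rewrite -[r t in leLHS](max_idPl rt0); exact: dist_max0_le.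
have h0s : (L1dist `[0%R, N] h0 (steps d cs) <= (e / 3)%:E)%E.
  by rewrite -[e / 3](divfK (lt0r_neq0 N0)); exact: L1dist_itv_le.
have tail_eq : L1dist (@Rplus R) (r \o shift N) (steps d cs \o shift N) = mass (r \o shift N).
  rewrite /mass; apply: eq_integral_gt0.
  - by apply: measurable_dist; apply: measurable_weight; exact: weight_shift.
  - by apply: measurable_weight; exact: weight_shift.
  move=> t t0; have tN : 0 <= shift N t by rewrite /shift addr_ge0 // ltW.
  rewrite /= steps_out //; last by rewrite size_cs /shift ltrDr.
  by rewrite subr0 ger0_norm // weight_ge0.
rewrite (L1dist_split N0' wr ws) tail_eq (_ : e = e / 3 + e / 3 + e / 3); last by field.
rewrite 2!EFinD; apply: leeD tail; apply: le_trans (leeD rh0 h0s).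
exact: L1dist_triangle.
Qed.

End StepApproximation.

(** * Abelian and Tauberian comparison *)

Section UniformConvergence.
Variables (R : realType) (X : choiceType) (Om : set X).

Lemma uniform_cvgP T (F : set_system T) {FF : Filter F} (G : T -> X -> R) (U : X -> R) :
  {uniform Om, G @ F --> U} <->
  forall e, 0 < e -> \forall l \near F, forall w, Om w -> `|G l w - U w| <= e.
Proof.
split=> [GU e e0|GU P /uniform_nbhs[E [/= entE EP]]].
  have UE : nbhs (U : {uniform` Om -> R}) [set h | forall w, Om w -> `|h w - U w| <= e].
    apply/uniform_nbhs; exists [set xy | ball xy.1 e xy.2]; split.
      exact: entourage_ball (PosNum e0).
    by move=> h hU w Ow; rewrite distrC ltW //; exact: hU.
  exact: GU UE.
move: entE; rewrite -entourage_ballE => -[e /= e0 eE].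
have e20 : 0 < e / 2 by rewrite divr_gt0.
apply: filterS (GU _ e20) => l Gl; apply: EP => w Ow; apply: eE => /=.
rewrite /ball /= distrC (le_lt_trans (Gl w Ow)) // ltr_pdivrMr // mulr_natr.
by rewrite mulr2n ltrDl.
Qed.

Lemma near_eq_uniform_cvg T (F : set_system T) {FF : Filter F} (G G' : T -> X -> R) U :
  (\forall l \near F, G l = G' l) -> {uniform Om, G @ F --> U} -> {uniform Om, G' @ F --> U}.
Proof.
move=> GG' /uniform_cvgP GU; apply/uniform_cvgP => e /GU.
by apply: filterS2 GG' => l ->.
Qed.

End UniformConvergence.

Section SupDeviation.
Variables (R : realType) (n : nat) (Om : set 'rV[R]_n).

Lemma sup_dev_cvgP T (F : set_system T) {FF : Filter F} (G : T -> 'rV[R]_n -> R) U :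
  Om !=set0 ->
  ((fun l => sup_dev Om (G l) U) @ F --> 0%E) <-> {uniform Om, G @ F --> U}.
Proof.
move=> [w0 Ow0]; rewrite uniform_cvgP.
have sup_le e l : (forall w, Om w -> `|G l w - U w| <= e) -> (sup_dev Om (G l) U <= e%:E)%E.
  by move=> Ge; apply: ge_ereal_sup => _ [w Ow <-]; rewrite lee_fin Ge.
have le_sup l w : Om w -> (`|G l w - U w|%:E <= sup_dev Om (G l) U)%E.
  by move=> Ow; apply: ereal_sup_ubound; exists w.
have fin l e : (forall w, Om w -> `|G l w - U w| <= e) -> sup_dev Om (G l) U \is a fin_num.
  move=> Ge; rewrite ge0_fin_numE ?(le_trans _ (le_sup l w0 Ow0)) ?lee_fin //.
  by rewrite (le_lt_trans (sup_le _ _ Ge)) // ltry.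
split=> [/fine_cvgP[finF /cvgrPdist_le cv] e e0|cv].
  apply: filterS2 finF (cv e e0) => l /= fl; rewrite sub0r normrN => close w Ow.
  rewrite -lee_fin (le_trans (le_sup _ _ Ow)) // -(fineK fl) lee_fin.
  exact: le_trans (ler_norm _) close.
apply/fine_cvgP; split; first by apply: filterS (cv 1 ltr01) => l; exact: fin.
apply/cvgrPdist_le => e e0; apply: filterS (cv e e0) => l Ge /=.
have fl := fin l e Ge; rewrite sub0r normrN ger0_norm; last first.
  by rewrite fine_ge0 // (le_trans _ (le_sup l w0 Ow0)) ?lee_fin.
by rewrite -lee_fin fineK // sup_le.
Qed.

End SupDeviation.

Section AtRightZero.
Variable R : realType.

Lemma cvg_to_at_right T (F : set_system T) {FF : Filter F} (f : T -> R) (a : R) :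
  (\forall x \near F, a < f x) -> f @ F --> a -> f @ F --> a^'+.
Proof. by move=> af fa P aP; apply: filterS2 af (fa _ aP) => x ax; apply. Qed.

Lemma cvg_invr_at_right : x^-1 @[x --> (0 : R)^'+] --> +oo.
Proof.
apply/cvgrVy; last exact: cvg_at_right_filter.
exact: nbhs_right_gt.
Qed.

Lemma cvg_invr_pinfty : x^-1 @[x --> (+oo : set_system R)] --> (0 : R)^'+.
Proof.
have pos : \forall x \near (+oo : set_system R), 0 < x by exact: nbhs_pinfty_gt.
apply: cvg_to_at_right; last exact/gtr0_cvgV0.
by apply: filterS pos => x; rewrite invr_gt0.
Qed.

End AtRightZero.

Section SwitchingValueTheory.
Variables (R : realType) (X : choiceType) (Om : set X) (V : (R -> R) -> X -> R).
Hypothesis sV : switching_value Om V.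
Implicit Types (r : R -> R) (U : X -> R) (x : X) (c d e h l m I D T : R).

Lemma switching_value_dist r r' x I : weight r -> weight r' ->
  (L1dist (@Rplus R) r r' <= I%:E)%E -> `|V r x - V r' x| <= I.
Proof.
move=> wr wr' rr'; have := switching_value_lipschitz sV x wr wr' rr'.
rewrite L1distC in rr'; have := switching_value_lipschitz sV x wr' wr rr'.
by rewrite ler_norml => *; apply/andP; split; lra.
Qed.

Lemma switching_value_switch_dist r r' x h I D : weight r -> weight r' -> Om x -> 0 < h ->
  (L1dist `[0%R, h] r r' <= I%:E)%E ->
  (forall z, Om z -> `|V (r \o shift h) z - V (r' \o shift h) z| <= D) ->
  `|V r x - V r' x| <= I + D.
Proof.
move=> wr wr' Ox h0 rr' VD.
have : V r x <= V r' x + (I + D).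
  by apply: (switching_value_switch sV wr wr' Ox h0 rr') => z /VD;
    rewrite ler_norml => /andP[_]; lra.
have : V r' x <= V r x + (I + D).
  rewrite L1distC in rr'; apply: (switching_value_switch sV wr' wr Ox h0 rr') => z /VD.
  by rewrite ler_norml => /andP[+ _]; lra.
by rewrite ler_norml => *; apply/andP; split; lra.
Qed.

Lemma eq_switching_value r r' : weight r -> weight r' -> (forall t, 0 < t -> r t = r' t) ->
  V r = V r'.
Proof.
move=> wr wr' rr'; apply/funext => x; apply/eqP; rewrite -subr_eq0 -normr_le0.
by apply: switching_value_dist; rewrite // L1dist_gt0_eq //; exact: measurable_weight.
Qed.

Lemma switching_value0 x : V (fun=> 0) x = 0.
Proof.
have := switching_valueZ sV x (ltr0n R 2) (weight0 R).
by under eq_fun do rewrite mulr0; lra.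
Qed.

Lemma switching_value_le_mass r x : weight r -> V r x <= fine (mass r).
Proof.
move=> wr; rewrite -[leRHS]add0r -(switching_value0 x).
apply: (switching_value_lipschitz sV _ wr (weight0 R)).
rewrite fineK ?mass_fin_num // [leLHS](_ : _ = mass r) //; apply: eq_mass => t t0.
by rewrite subr0 ger0_norm // weight_ge0.
Qed.

Lemma switching_value_box c T x : 0 < c -> 0 <= T -> V (box c T) x = c * T * V (varpi T) x.
Proof.
move=> c0; rewrite le_eqVlt => /predU1P[<-|T0].
  rewrite mulr0 mul0r (@eq_switching_value _ (fun=> 0)) ?switching_value0 //.
  - by apply: weight_box => //; exact: ltW.
  - exact: weight0.
  - by move=> t t0; rewrite boxE leNgt t0.
have wT := weight_varpi (ltW T0); have cT := mulr_gt0 c0 T0.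
rewrite -(switching_valueZ sV x cT wT).
apply: (congr1 (@^~ x)); apply: eq_switching_value.
- by apply: weight_box; exact: ltW.
- exact: weightZ (ltW cT) wT.
- move=> t t0; rewrite varpi_box ?ltW // !boxE.
  by case: ifP => _; rewrite ?mulr0 // mulfK // gt_eqF.
Qed.

Lemma uniform_limit_itv S (F : set_system S) {FF : ProperFilter F} (r : S -> R -> R) U w :
  {uniform Om, (fun s => V (r s)) @ F --> U} ->
  (\forall s \near F, weight (r s) /\ (mass (r s) = 1)%E) -> Om w -> 0 <= U w <= 1.
Proof.
move=> /uniform_cvgP VU unit_mass Ow.
have approx e : 0 < e -> exists2 v, `|v - U w| <= e & 0 <= v <= 1.
  move=> e0; have [s [[wr mass1] close]] := filter_ex (filterI unit_mass (VU e e0)).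
  exists (V (r s) w); first exact: close.
  rewrite (switching_value_ge0 sV) //.
  by apply: le_trans (switching_value_le_mass w wr) _; rewrite mass1.
by apply/andP; split; apply/ler_addgt0Pr => e /approx[v + /andP[v0 v1]];
  rewrite ler_norml => /andP[]; lra.
Qed.

Definition scaling_limit U r := {uniform Om, (fun l => V (rho_scale r l)) @ 0^'+ -->
  (fun w => fine (mass r) * U w)}.

Lemma scaling_limit_density U r : density r ->
  scaling_limit U r <-> {uniform Om, (fun l => V (rho_scale r l)) @ 0^'+ --> U}.
Proof.
move=> dr; rewrite /scaling_limit mass_density //.
by rewrite (_ : (fun w => _) = U) //; apply/funext => w; rewrite mul1r.
Qed.

Lemma scaling_limit_box U c T : {uniform Om, (fun T => V (varpi T)) @ +oo --> U} ->
  0 < c -> 0 <= T -> scaling_limit U (box c T).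
Proof.
move=> VU c0 T0; apply/uniform_cvgP => e e0.
rewrite mass_box ?(ltW c0) //=; have [->|Tn0] := eqVneq T 0.
  near=> l => w Ow; have l0 : 0 < l by near: l; exact: nbhs_right_gt.
  rewrite rho_scale_box // mul0r switching_value_box ?mulr_gt0 //.
  by rewrite !mulr0 !mul0r subrr normr0 ltW.
have {}T0 : 0 < T by rewrite lt_def Tn0.
have cT := mulr_gt0 c0 T0.
have /uniform_cvgP/(_ _ (divr_gt0 e0 cT)) VU_T :
    {uniform Om, (fun l => V (varpi (T / l))) @ 0^'+ --> U}.
  by apply: cvg_comp VU; apply: gt0_cvgMry => //; exact: cvg_invr_at_right.
near=> l => w Ow; have l0 : 0 < l by near: l; exact: nbhs_right_gt.
rewrite rho_scale_box // switching_value_box ?mulr_gt0 ?divr_ge0 ?(ltW l0) ?(ltW T0) //.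
have -> : l * c * (T / l) = c * T by field; rewrite gt_eqF.
rewrite -mulrBr normrM gtr0_norm // [leLHS]mulrC -ler_pdivlMr //.
by move: w Ow; near: l.
Unshelve. all: by end_near. Qed.

Lemma scaling_limit_paste U c d r : {uniform Om, (fun T => V (varpi T)) @ +oo --> U} ->
  0 < c -> 0 < d -> weight r -> scaling_limit U r -> scaling_limit U (paste d (fun=> c) r).
Proof.
move=> VU c0 d0 wr rU; have [c0' d0'] := (ltW c0, ltW d0).
set M := fine (mass r); have M0 : 0 <= M by rewrite fine_ge0 ?mass_ge0.
pose T := M / c; have T0 : 0 <= T by rewrite divr_ge0.
have Td0 : 0 <= T + d by rewrite addr_ge0.
have massE : fine (mass (paste d (fun=> c) r)) = fine (mass (box c (T + d))).
  rewrite mass_box // mass_paste_cst // fineD ?mass_fin_num //= -/M /T.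
  by field; rewrite gt_eqF.
have massT : fine (mass (box c T)) = M by rewrite mass_box //= /T mulrC divfK // gt_eqF.
have wp : weight (paste d (fun=> c) r) by exact: weight_paste_cst.
have wb : weight (box c (T + d)) by exact: weight_box.
apply/uniform_cvgP => e e0; rewrite massE; have e30 : 0 < e / 3 by rewrite divr_gt0.
have /uniform_cvgP/(_ _ e30) := scaling_limit_box VU c0 Td0; rewrite -/M => boxTd.
have /uniform_cvgP/(_ _ e30) := scaling_limit_box VU c0 T0; rewrite massT => boxT.
move/uniform_cvgP/(_ _ e30) : rU => rU.
near=> l => w Ow; have l0 : 0 < l by near: l; exact: nbhs_right_gt.
have dl0 : 0 < d / l by rewrite divr_gt0.
apply: le_trans (ler_distD (V (rho_scale (box c (T + d)) l) w) _ _) _.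
rewrite (_ : e = (0 + (e / 3 + e / 3)) + e / 3); last by field.
apply: lerD; last by move: w Ow; near: l.
have [wpl wbl] := (weight_rho_scale l0 wp, weight_rho_scale l0 wb).
apply: (switching_value_switch_dist (h := d / l) wpl wbl) => //.
  rewrite /L1dist integral0_eq // => t; rewrite /= in_itv => /andP[t0 tdl].
  have ltd : l * t <= d by rewrite mulrC -ler_pdivlMr.
  by rewrite /rho_scale paste_le // box_le ?subrr ?normr0 // (le_trans ltd) // lerDr.
move=> z Oz.
have -> : V (rho_scale (paste d (fun=> c) r) l \o shift (d / l)) = V (rho_scale r l).
  apply: eq_switching_value => [||t t0]; first exact: weight_shift (ltW dl0) wpl.
    exact: weight_rho_scale.
  by rewrite /= rho_scale_shift // /rho_scale /= paste_gt // mulr_gt0.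
have -> : rho_scale (box c (T + d)) l \o shift (d / l) = rho_scale (box c T) l.
  by apply/funext => t; rewrite /= rho_scale_shift // /rho_scale /= box_shift.
apply: le_trans (ler_distD (M * U z) _ _) (lerD _ _).
  by move: z Oz; near: l.
by rewrite distrC; move: z Oz; near: l.
Unshelve. all: by end_near. Qed.

Lemma scaling_limit_closed U r : (forall w, Om w -> 0 <= U w <= 1) -> weight r ->
  (forall e, 0 < e -> exists r', [/\ weight r', scaling_limit U r' &
     (L1dist (@Rplus R) r r' <= e%:E)%E]) -> scaling_limit U r.
Proof.
move=> U01 wr approx; apply/uniform_cvgP => e e0; have e30 : 0 < e / 3 by rewrite divr_gt0.
have [r' [wr' /uniform_cvgP/(_ _ e30) r'U rr']] := approx _ e30.
near=> l => w Ow; have l0 : 0 < l by near: l; exact: nbhs_right_gt.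
have close : `|V (rho_scale r l) w - V (rho_scale r' l) w| <= e / 3.
  by apply: switching_value_dist; rewrite ?L1dist_rho_scale //; exact: weight_rho_scale.
have limit : `|V (rho_scale r' l) w - fine (mass r') * U w| <= e / 3.
  by move: w Ow {close}; near: l.
have masses : `|fine (mass r') * U w - fine (mass r) * U w| <= e / 3.
  have /andP[U0 U1] := U01 w Ow; rewrite -mulrBl normrM (ger0_norm U0).
  rewrite distrC; apply: le_trans (dist_mass_le wr wr' rr').
  by rewrite ler_piMr.
apply: le_trans (ler_distD (V (rho_scale r' l) w) _ _) _.
rewrite (_ : e = e / 3 + (e / 3 + e / 3)); last by field.
exact: lerD close (le_trans (ler_distD _ _ _) (lerD limit masses)).
Unshelve. all: by end_near. Qed.

Lemma scaling_limit_steps U d cs : {uniform Om, (fun T => V (varpi T)) @ +oo --> U} ->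
  0 < d -> all (fun c => 0 < c) cs -> scaling_limit U (steps d cs).
Proof.
move=> VU d0; elim: cs => [_|c cs IH /= /andP[c0 cs0]]; last first.
  exact: scaling_limit_paste VU c0 d0 (weight_steps (ltW d0) cs0) (IH cs0).
apply/uniform_cvgP => e e0; near=> l => w _.
have -> : rho_scale (steps d [::]) l = (fun=> 0).
  by apply/funext => t; rewrite /rho_scale mulr0.
by rewrite switching_value0 mass0 mul0r subrr normr0 ltW.
Unshelve. all: by end_near. Qed.

Lemma abelian U r : {uniform Om, (fun T => V (varpi T)) @ +oo --> U} ->
  weight r -> scaling_limit U r.
Proof.
move=> VU wr; apply: scaling_limit_closed => // [w Ow|e e0].
  apply: (uniform_limit_itv VU) => //; near=> T.
  have T0 : 0 < T by near: T; exact: nbhs_pinfty_gt.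
  by split; [exact/weight_varpi/ltW|exact: mass_varpi].
have [d [cs [d0 cs0 close]]] := steps_dense wr e0.
exists (steps d cs); split=> //; first exact: weight_steps (ltW d0) cs0.
exact: scaling_limit_steps.
Unshelve. all: by end_near. Qed.

End SwitchingValueTheory.

Section SelfSimilarDensities.
Variable R : realType.
Local Notation leb := (@lebesgue_measure R).
Implicit Types (mu : R -> R) (s t k m : R).

Definition self_similar mu := forall s, 0 <= s -> exists k m,
  [/\ 0 < k <= 1, 0 < m & forall t, 0 <= t -> mu (shift s t) = m * rho_scale mu k t].

Record tauberian_density mu : Prop := TauberianDensity {
  density_of_tauberian : density mu;
  tauberian_gt0 : 0 < mu 0;
  tauberian_bounds : exists2 C, 0 <= C &
    forall t, 0 <= t -> mu 0 * (1 - C * t) <= mu t <= mu 0;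
  tauberian_self_similar : self_similar mu }.

Lemma self_similar_tail mu s k m : weight mu -> 0 < k -> 0 < m ->
  (forall t, 0 <= t -> mu (shift s t) = m * rho_scale mu k t) ->
  mass (mu \o shift s) = (m%:E * mass mu)%E.
Proof.
move=> wmu k0 m0 mu_s; rewrite (eq_mass mu_s) massZ ?(ltW m0) ?mass_rho_scale //.
exact: weight_rho_scale.
Qed.

Lemma tail_mass_itv mu lo hi s : density mu -> 0 <= s ->
  (forall t, 0 <= t <= s -> lo <= mu t <= hi) ->
  1 - hi * s <= fine (mass (mu \o shift s)) <= 1 - lo * s.
Proof.
move=> dmu s0 mu_itv; have wmu := density_weight dmu; have [mu0 [mmu _]] := dmu.
have wms := weight_shift s0 wmu.
have mS : measurable_fun `[0, s] (EFin \o mu).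
  by apply/measurable_EFinP; exact: measurable_fun_RplusW.
have head_ge0 : (0 <= \int[leb]_(t in `[0%R, s]) (mu t)%:E)%E.
  by apply: integral_ge0 => t /sub_itv_Rplus t0; rewrite lee_fin mu0.
have head_le : (\int[leb]_(t in `[0%R, s]) (mu t)%:E <= (hi * s)%:E)%E.
  rewrite -integral_itv0_cst //; apply: ge0_le_integral => //.
  - by move=> t /sub_itv_Rplus t0; rewrite lee_fin mu0.
  - by move=> t; rewrite /= in_itv lee_fin => /mu_itv/andP[].
have head_ge : ((lo * s)%:E <= \int[leb]_(t in `[0%R, s]) (mu t)%:E)%E.
  have [lo0|lo0] := leP lo 0.
    by apply: le_trans head_ge0; rewrite lee_fin mulr_le0_ge0.
  rewrite -integral_itv0_cst //; apply: ge0_le_integral => //.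
  - by move=> t _; rewrite lee_fin ltW.
  - by move=> t; rewrite /= in_itv lee_fin => /mu_itv/andP[].
have head_fin : (\int[leb]_(t in `[0%R, s]) (mu t)%:E)%E \is a fin_num.
  by rewrite ge0_fin_numE // (le_lt_trans head_le) // ltry.
have := mass_split s0 wmu; rewrite mass_density //.
move: head_le head_ge; rewrite -(fineK head_fin) -(fineK (mass_fin_num wms)) -EFinD !lee_fin.
by move=> head_le head_ge [mass_eq]; apply/andP; split; lra.
Qed.

Section MatchedWeight.
Variables (mu : R -> R) (C K tau : R).
Hypotheses (dmu : density mu) (mu0 : 0 < mu 0) (C0 : 0 <= C) (K1 : 1 <= K) (tau0 : 0 < tau).
Hypothesis mu_bounds : forall t, 0 <= t -> mu 0 * (1 - C * t) <= mu t <= mu 0.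

(* The scaling of [mu] that has mass [K] and the height [1 / tau] of the box at 0. *)
Definition matched_weight (t : R) : R := K * rho_scale mu (K * mu 0 * tau)^-1 t.

Let K0 : 0 < K. Proof. exact: lt_le_trans K1. Qed.

Local Notation l := ((K * mu 0 * tau)^-1).

Let l0 : 0 < l. Proof. by rewrite invr_gt0 !mulr_gt0. Qed.

Lemma weight_matched : weight matched_weight.
Proof. exact/(weightZ (ltW K0))/weight_rho_scale/density_weight. Qed.

Lemma matched_weight_head :
  (L1dist `[0%R, tau] (box tau^-1 (K * tau)) matched_weight <= (C / mu 0 / K)%:E)%E.
Proof.
have Kl : K * l * mu 0 = tau^-1 by field; rewrite !gt_eqF.
have ti0 := ltW tau0; have ti1 : 0 <= tau^-1 by rewrite invr_ge0.
have -> : C / mu 0 / K = C * l * tau by field; rewrite !gt_eqF.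
have wb : weight (box tau^-1 (K * tau)) by apply: weight_box; rewrite ?mulr_ge0 ?(ltW K0).
apply: L1dist_itv_le => //.
- by apply: measurable_fun_RplusW; exact: measurable_weight.
- by apply: measurable_fun_RplusW; apply: measurable_weight; exact: weight_matched.
move=> t /andP[/ltW t0 tt]; rewrite box_le; last by rewrite (le_trans tt) // ler_peMl.
have lt0 : 0 <= l * t by rewrite mulr_ge0 // ltW.
have /andP[mu_ge mu_le] := mu_bounds lt0.
rewrite /matched_weight /rho_scale -Kl -mulrA -mulrBr -mulrBr mulrA normrM.
rewrite (gtr0_norm (mulr_gt0 K0 l0)) ger0_norm ?subr_ge0 //.
apply: (@le_trans _ _ (K * l * (mu 0 * (C * (l * tau))))).
  rewrite ler_pM2l ?mulr_gt0 //; apply: (@le_trans _ _ (mu 0 * (C * (l * t)))); first by lra.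
  by rewrite ler_pM2l // ler_wpM2l // ler_pM2l.
by rewrite [leLHS](_ : _ = C * l) //; field; rewrite !gt_eqF.
Qed.

Lemma matched_weight_tail : self_similar mu -> exists k m,
  [/\ 0 < k <= 1, 0 < m, K - 1 <= m <= K, m <= K - 1 + C / mu 0 / K &
      forall t, 0 <= t -> matched_weight (shift tau t) = m * rho_scale mu (k * l) t].
Proof.
move=> ss; pose s := l * tau; have s0 : 0 <= s by rewrite mulr_ge0 ?ltW.
have sE : s = (K * mu 0)^-1 by rewrite /s; field; rewrite !gt_eqF.
have [k [m [/andP[k0 k1] m0 mu_s]]] := ss s s0; have wmu := density_weight dmu.
have mass_m : fine (mass (mu \o shift s)) = m.
  by rewrite (self_similar_tail wmu k0 m0 mu_s) mass_density // mule1.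
have m1 : m <= 1.
  rewrite -lee_fin -mass_m fineK; last exact/mass_fin_num/weight_shift.
  by rewrite (le_trans (mass_shift_le s0 wmu)) // mass_density.
have : 1 - mu 0 * s <= m <= 1 - mu 0 * (1 - C * s) * s.
  rewrite -mass_m; apply: tail_mass_itv => // t /andP[t0 ts].
  have /andP[mu_ge ->] := mu_bounds t0; rewrite andbT (le_trans _ mu_ge) //.
  by rewrite ler_pM2l // lerD2l lerN2; exact: ler_wpM2l.
rewrite sE => /andP[m_ge m_le]; exists k, (K * m); split; [by rewrite k0|exact: mulr_gt0| | |].
- rewrite -[X in _ && (_ <= X)]mulr1 ler_pM2l // m1 andbT.
  have := ler_wpM2l (ltW K0) m_ge.
  by rewrite (_ : K * (1 - mu 0 * (K * mu 0)^-1) = K - 1) //; field; rewrite !gt_eqF.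
- have := ler_wpM2l (ltW K0) m_le.
  by rewrite (_ : K * (1 - _) = K - 1 + C / mu 0 / K) //; field; rewrite !gt_eqF.
move=> t t0; have lt0 : 0 <= l * t by rewrite mulr_ge0 // ltW.
rewrite /matched_weight /rho_scale [shift tau t]/(t + tau) mulrDr -/s.
rewrite -[l * t + s]/(shift s _) mu_s //; rewrite /rho_scale.
by rewrite !mulrA; congr (_ * _); ring.
Qed.

End MatchedWeight.

End SelfSimilarDensities.

Section Tauberian.
Variables (R : realType) (X : choiceType) (Om : set X) (V : (R -> R) -> X -> R).
Hypothesis sV : switching_value Om V.
Variables (mu : R -> R) (C : R) (U : X -> R).
Hypotheses (dmu : density mu) (mu0 : 0 < mu 0) (C0 : 0 <= C).
Hypothesis mu_bounds : forall t, 0 <= t -> mu 0 * (1 - C * t) <= mu t <= mu 0.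
Hypothesis ss : self_similar mu.
Hypothesis U01 : forall w, Om w -> 0 <= U w <= 1.
Implicit Types (k : nat) (w : X) (e tau : R).

Section Blocks.
Variables (e tau : R).
Hypotheses (tau0 : 0 < tau).
Hypothesis close : forall l, 0 < l <= (mu 0 * tau)^-1 -> forall w, Om w ->
  `|V (rho_scale mu l) w - U w| <= e.

Local Notation c := (C / mu 0).

Lemma matched_scale_itv k : 0 < (k.+1%:R * mu 0 * tau)^-1 <= (mu 0 * tau)^-1.
Proof.
rewrite invr_gt0 !mulr_gt0 //= lef_pV2 ?posrE ?mulr_gt0 // -mulrA ler_peMl ?ler1n //.
by rewrite mulr_ge0 // ltW.
Qed.

Lemma block_tail_dist k D z : Om z ->
  `|V (box tau^-1 (k%:R * tau)) z - k%:R * U z| <= D ->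
  `|V (box tau^-1 (k.+1%:R * tau) \o shift tau) z -
    V (matched_weight mu k.+1%:R tau \o shift tau) z| <= D + c / k.+1%:R + k.+1%:R * e.
Proof.
move=> Oz kD; set K : R := k.+1%:R; have K1 : 1 <= K by rewrite ler1n.
have kK : k%:R = K - 1 :> R by rewrite /K -natr1 addrK.
have [kap [m [/andP[kap0 kap1] m0 /andP[m_ge m_le] m_le_c r_tail]]] :=
  matched_weight_tail dmu mu0 C0 K1 tau0 mu_bounds ss.
have /andP[l0 l_le] := matched_scale_itv k; set l := (_ * tau)^-1 in l0 l_le r_tail.
have kl0 : 0 < kap * l by rewrite mulr_gt0.
have wkl := weight_rho_scale kl0 (density_weight dmu).
have -> : box tau^-1 (K * tau) \o shift tau = box tau^-1 (k%:R * tau).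
  apply/funext => t; rewrite /= -[in RHS](box_shift _ _ tau).
  by congr (box _ _ _); rewrite kK; ring.
have -> : V (matched_weight mu K tau \o shift tau) z = m * V (rho_scale mu (kap * l)) z.
  rewrite -(switching_valueZ sV) //; apply: (congr1 (@^~ z)).
  apply: (eq_switching_value sV) => [||t /ltW]; last exact: r_tail.
    exact: weight_shift (ltW tau0) (weight_matched dmu mu0 K1 tau0).
  exact: weightZ (ltW m0) wkl.
have /andP[U0 U1] := U01 Oz.
have Vkap : `|V (rho_scale mu (kap * l)) z - U z| <= e.
  by apply: close => //; rewrite kl0 (le_trans _ l_le) // ler_piMl // ltW.
apply: le_trans (ler_distD (k%:R * U z) _ _) _; rewrite -addrA; apply: lerD kD _.
apply: le_trans (ler_distD (m * U z) _ _) _; rewrite -mulrBl -mulrBr !normrM; apply: lerD.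
  rewrite kK distrC (ger0_norm U0) ger0_norm ?subr_ge0 //.
  by apply: le_trans (_ : m - (K - 1) <= _); [rewrite ler_piMr // subr_ge0|rewrite lerBlDl].
by rewrite distrC (gtr0_norm m0) ler_pM // ltW.
Qed.

Lemma block_step k D :
  (forall w, Om w -> `|V (box tau^-1 (k%:R * tau)) w - k%:R * U w| <= D) ->
  forall w, Om w -> `|V (box tau^-1 (k.+1%:R * tau)) w - k.+1%:R * U w| <=
    D + 2 * (c / k.+1%:R + k.+1%:R * e).
Proof.
move=> kD w Ow; set K : R := k.+1%:R; have K1 : 1 <= K by rewrite ler1n.
have K0 : 0 < K by exact: lt_le_trans K1.
pose r := matched_weight mu K tau; have wr : weight r by exact: weight_matched.
have wb : weight (box tau^-1 (K * tau)).
  by apply: weight_box; rewrite ?mulr_ge0 ?invr_ge0 // ltW.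
have head := matched_weight_head dmu mu0 C0 K1 tau0 mu_bounds.
have box_r := switching_value_switch_dist sV wb wr Ow tau0 head
  (fun z Oz => block_tail_dist Oz (kD z Oz)).
have r_U : `|V r w - K * U w| <= K * e.
  have lK := matched_scale_itv k; have /andP[l0 _] := lK.
  rewrite (switching_valueZ sV) //; last exact/weight_rho_scale/density_weight.
  by rewrite -mulrBr normrM (gtr0_norm K0) ler_pM2l // close.
apply: le_trans (ler_distD (V r w) _ _) (le_trans (lerD box_r r_U) _).
by rewrite [leLHS](_ : _ = D + 2 * (c / K + K * e)) //; ring.
Qed.

Lemma box_blocks_dist N w : Om w -> `|V (box tau^-1 (N%:R * tau)) w - N%:R * U w| <=
  2 * (C / mu 0 * series harmonic N + N%:R ^+ 2 * e).
Proof.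
have l0 : 0 < (mu 0 * tau)^-1 <= (mu 0 * tau)^-1 by rewrite lexx andbT invr_gt0 mulr_gt0.
elim: N w => [|N IH] w Ow.
  rewrite mul0r (@eq_switching_value _ _ _ _ sV _ (fun=> 0)) ?(switching_value0 sV).
  - by rewrite mul0r subrr normr0 /series /= big_geq // expr0n /= mulr0 mul0r addr0 mulr0.
  - by apply: weight_box; rewrite ?invr_ge0 ?(ltW tau0).
  - exact: weight0.
  - by move=> t t0; rewrite boxE leNgt t0.
apply: le_trans (block_step IH Ow) _.
rewrite /series /= big_nat_recr //= -/(series harmonic N).
have e0 := le_trans (normr_ge0 _) (close l0 Ow); have N0 : 0 <= N%:R :> R by [].
rewrite -[N.+1%:R]natr1; nra.
Qed.

End Blocks.

Lemma self_similar_tauberian : {uniform Om, (fun l => V (rho_scale mu l)) @ 0^'+ --> U} ->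
  {uniform Om, (fun T => V (varpi T)) @ +oo --> U}.
Proof.
move=> VU; apply/uniform_cvgP => e e0; have C0' : 0 <= C / mu 0 by rewrite divr_ge0 // ltW.
have e40 : 0 < e / 4 by rewrite divr_gt0.
have : (fun n => C / mu 0 * arithmetic_mean harmonic n) @ \oo --> C / mu 0 * 0.
  by apply: cvgMl_tmp; apply: cesaro; exact: cvg_harmonic.
rewrite mulr0 => /cvgrPdist_le/(_ _ e40)[n _ /(_ n (leqnn _)) /= mean_small].
pose N : R := n.+1%:R; have N0 : 0 < N by rewrite ltr0n.
have e4N : 0 < e / (4 * N) by rewrite divr_gt0 // mulr_gt0.
move/uniform_cvgP/(_ _ e4N) : VU => [d /= d0 close].
near=> T => w Ow; have T0 : 0 < T by near: T; exact: nbhs_pinfty_gt.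
pose tau := T / N; have tau0 : 0 < tau by rewrite divr_gt0.
have NtT : N * tau = T by rewrite /tau mulrC divfK // gt_eqF.
have small : (mu 0 * tau)^-1 < d.
  have : N / (mu 0 * d) < T by near: T; apply: nbhs_pinfty_gt; exact: num_real.
  rewrite ltr_pdivrMr ?mulr_gt0 // invf_plt ?posrE ?(mulr_gt0 mu0 tau0) // => NT.
  by rewrite /tau mulrA ltr_pdivlMr // ltr_pdivrMl // mulrA mulrC (mulrC d).
have near0 l : 0 < l <= (mu 0 * tau)^-1 -> forall w, Om w ->
    `|V (rho_scale mu l) w - U w| <= e / (4 * N).
  move=> /andP[l0 lsmall]; apply: close => //=.
  by rewrite sub0r normrN gtr0_norm // (le_lt_trans lsmall).
have := box_blocks_dist tau0 near0 n.+1 Ow.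
rewrite NtT (switching_value_box sV) ?invr_gt0 ?(ltW T0) //.
have -> : tau^-1 * T = N by rewrite -NtT mulrCA mulVf ?mulr1 // gt_eqF.
rewrite -mulrBr normrM (gtr0_norm N0) => dist.
rewrite -(ler_pM2l N0); apply: le_trans dist _.
rewrite sub0r normrN in mean_small; have := le_trans (ler_norm _) mean_small.
rewrite /arithmetic_mean /= -/N mulrCA ler_pdivrMl // => mean_le.
rewrite (_ : N ^+ 2 * (e / (4 * N)) = N * (e / 4)); last by field; rewrite gt_eqF.
by lra.
Unshelve. all: by end_near. Qed.

End Tauberian.

Lemma tauberian (R : realType) (X : choiceType) (Om : set X) (V : (R -> R) -> X -> R)
    (mu : R -> R) (U : X -> R) :
  switching_value Om V -> tauberian_density mu ->
  {uniform Om, (fun l => V (rho_scale mu l)) @ 0^'+ --> U} ->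
  {uniform Om, (fun T => V (varpi T)) @ +oo --> U}.
Proof.
move=> sV [dmu mu0 [C C0 mu_bounds] ss] VU.
apply: (self_similar_tauberian sV dmu mu0 C0 mu_bounds ss _ VU) => w Ow.
apply: (uniform_limit_itv sV VU _ Ow); near=> l; have l0 : 0 < l by near: l; exact: nbhs_right_gt.
have wmu := density_weight dmu.
by split; [exact: weight_rho_scale|rewrite mass_rho_scale // mass_density].
Unshelve. all: by end_near. Qed.

Lemma tauberian_density_limitP (R : realType) (X : choiceType) (Om : set X)
    (V : (R -> R) -> X -> R) (mu : R -> R) (U : X -> R) :
  switching_value Om V -> tauberian_density mu ->
  {uniform Om, (fun l => V (rho_scale mu l)) @ 0^'+ --> U} <->
  {uniform Om, (fun T => V (varpi T)) @ +oo --> U}.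
Proof.
move=> sV tmu; split=> [|VU]; first exact: tauberian.
have dmu := density_of_tauberian tmu.
exact/(scaling_limit_density _ _ _ dmu)/(abelian sV VU)/density_weight.
Qed.

(** * Exponential, uniform and power densities *)

Section ExponentialDensity.
Variable R : realType.
Local Notation leb := (@lebesgue_measure R).

Definition exp_density (t : R) : R := expR (- t).

Lemma density_exp_density : density exp_density.
Proof.
split=> [t _|]; first exact: expR_ge0.
split; first by apply: measurable_funTS; exact: measurableT_comp.
rewrite RplusE integral_mkcond -(integral_exponential_pdf (@ltr01 R)).
apply: eq_integral => t _; rewrite /exponential_pdf /patch.
by case: ifP; rewrite //= mul1r mulN1r.
Qed.

Lemma tauberian_exp_density : tauberian_density exp_density.
Proof.
have exp0 : exp_density 0 = 1 by rewrite /exp_density oppr0 expR0.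
split; rewrite ?exp0 //; first exact: density_exp_density.
  exists 1 => // t t0; rewrite !mul1r expR_ge1Dx /=.
  by rewrite -[leRHS]expR0 ler_expR oppr_le0.
move=> s s0; exists 1, (expR (- s)); split; rewrite ?expR_gt0 ?ltr01 ?lexx //= => t t0.
by rewrite /rho_scale !mul1r -expRD /exp_density /shift opprD addrC.
Qed.

End ExponentialDensity.

Section UniformDensity.
Variable R : realType.

Lemma density_varpi (T : R) : 0 < T -> density (varpi T).
Proof.
move=> T0; have [w0 mw _] := weight_varpi (ltW T0); split=> //; split=> //.
exact: mass_varpi.
Qed.

Lemma piecewise_continuous_varpi (T : R) : 0 < T -> piecewise_continuous (varpi T).
Proof.
move=> T0 u v u0 uv; exists [:: T]; split.
  move=> t /andP[ut _]; rewrite inE => tT; have t0 : 0 < t by exact: lt_le_trans ut.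
  have [ltT|leT] := ltP t T.
    apply: cvg_near_cst; near=> x; rewrite /varpi.
    have x0 : 0 < x by near: x; exact: lt_nbhsr.
    have xT : x < T by near: x; exact: lt_nbhsl.
    by rewrite !ltW.
  have Tt : T < t by rewrite lt_neqAle eq_sym tT.
  apply: cvg_near_cst; near=> x; rewrite /varpi.
  have Tx : T < x by near: x; exact: lt_nbhsr.
  by rewrite [x <= T]leNgt Tx [t <= T]leNgt Tt !andbF.
move=> t; rewrite inE => /eqP ->; split; last first.
  exists 0; apply: cvg_near_cst; near=> x; rewrite /varpi.
  have xT : T < x by near: x; exact: nbhs_right_gt.
  by rewrite [x <= T]leNgt xT andbF.
exists T^-1; apply: cvg_near_cst; near=> x; rewrite /varpi.
have x0 : 0 < x by near: x; exact: nbhs_left_gt.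
have xT : x < T by near: x; exact: nbhs_left_lt.
by rewrite !ltW.
Unshelve. all: by end_near. Qed.

Lemma varpi_scaling_cvg (X : choiceType) (Om : set X) (V : (R -> R) -> X -> R) U :
  switching_value Om V ->
  {uniform Om, (fun l => V (rho_scale (varpi 1) l)) @ 0^'+ --> U} ->
  {uniform Om, (fun T => V (varpi T)) @ +oo --> U}.
Proof.
move=> sV VU; apply: near_eq_uniform_cvg (cvg_comp _ _ (@cvg_invr_pinfty R) VU).
near=> T; have T0 : 0 < T by near: T; exact: nbhs_pinfty_gt.
apply: (eq_switching_value sV) => [||t /ltW t0]; last by rewrite varpi_rho_scale.
  by apply: weight_rho_scale; rewrite ?invr_gt0 //; exact: weight_varpi.
exact/weight_varpi/ltW.
Unshelve. all: by end_near. Qed.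

End UniformDensity.

Section PowerDensity.
Variables (R : realType) (rho : R -> R) (al be ga : R).
Local Notation leb := (@lebesgue_measure R).
Implicit Types (s t T : R).
Hypotheses (al0 : 0 < al) (be0 : 0 < be) (ga0 : 0 < ga).
Hypothesis rhoE : forall t, 0 <= t -> rho t = (al + be * t) `^ (- ga).
Hypothesis drho : density rho.

Let affine_gt0 T : 0 <= T -> 0 < al + be * T.
Proof. by move=> T0; rewrite ltr_pwDl // mulr_ge0 // ltW. Qed.

Lemma power_density_bounds t : 0 <= t ->
  rho 0 * (1 - ga * be / al * t) <= rho t <= rho 0.
Proof.
move=> t0; rewrite !rhoE // mulr0 addr0.
pose u := be / al * t; have u0 : 0 <= u by rewrite mulr_ge0 // divr_ge0 // ltW.
have -> : al + be * t = al * (1 + u) by rewrite /u; field; rewrite gt_eqF.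
have u1 : 0 < 1 + u by rewrite ltr_pwDl.
rewrite (powRM _ (ltW al0) (ltW u1)); set P := al `^ _; have P0 : 0 < P by exact: powR_gt0.
have powE : (1 + u) `^ (- ga) = expR (- ga * ln (1 + u)) by rewrite /powR gt_eqF.
have pow_ge : 1 - ga * u <= (1 + u) `^ (- ga).
  rewrite powE; apply: le_trans (expR_ge1Dx _); rewrite lerD2l mulNr lerN2 ler_pM2l //.
  by apply: le_ln1Dx; apply: lt_le_trans u0.
have pow_le : (1 + u) `^ (- ga) <= 1.
  rewrite powE -[leRHS]expR0 ler_expR mulNr oppr_le0 mulr_ge0 ?(ltW ga0) //.
  by apply: ln_ge0; rewrite lerDl.
rewrite ler_pM2l // (_ : ga * be / al * t = ga * u); last by rewrite /u; ring.
by rewrite pow_ge /= -[leRHS]mulr1 ler_pM2l.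
Qed.

Definition shift_factor T : R := al / (al + be * T).

Lemma shift_factor_itv T : 0 <= T -> 0 < shift_factor T <= 1.
Proof.
move=> T0; rewrite divr_gt0 ?affine_gt0 //= ler_pdivrMr ?affine_gt0 // mul1r lerDl.
by rewrite mulr_ge0 // ltW.
Qed.

Lemma power_density_shift s : 0 <= s -> exists2 m, 0 < m & forall t, 0 <= t ->
  rho (shift s t) = m * rho_scale rho (shift_factor s) t.
Proof.
move=> s0; have /andP[k0 _] := shift_factor_itv s0; have as0 := affine_gt0 s0.
set k := shift_factor s in k0 *.
exists (k^-1 `^ (- ga) / k); first by rewrite divr_gt0 // powR_gt0 // invr_gt0.
move=> t t0; have kt0 : 0 <= k * t by rewrite mulr_ge0 // ltW.
rewrite /rho_scale rhoE ?addr_ge0 // (rhoE kt0) [RHS]mulrA divfK ?gt_eqF //.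
rewrite -powRM ?invr_ge0 ?(ltW k0) ?(ltW (affine_gt0 kt0)) //.
by congr (_ `^ _); rewrite /shift /k /shift_factor; field; rewrite !gt_eqF.
Qed.

Lemma tauberian_power_density : tauberian_density rho.
Proof.
split=> //; first by rewrite rhoE // mulr0 addr0 powR_gt0.
  exists (ga * be / al); first by rewrite divr_ge0 ?mulr_ge0 // ltW.
  exact: power_density_bounds.
move=> s s0; have [m m0 rho_s] := power_density_shift s0.
by exists (shift_factor s), m; split=> //; exact: shift_factor_itv.
Qed.

Lemma tail_massE T : 0 <= T ->
  (\int[leb]_(s in [set s | (T <= s)%R]) (rho s)%:E = mass (rho \o shift T))%E.
Proof.
move=> T0; have -> : [set s | T <= s] = `[T, +oo[%classic.
  by apply/seteqP; split=> s /=; rewrite in_itv /= andbT.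
rewrite (integral_shift T) ?preimage_shift_ge //; apply/measurable_EFinP.
have [_ [mrho _]] := drho; apply: measurable_funS mrho; first exact: measurable_Rplus.
by move=> s /=; rewrite in_itv /= andbT; exact: le_trans.
Qed.

Lemma rho_shift_scale T t : 0 <= T -> 0 <= t ->
  rho_shift rho T t = rho_scale rho (shift_factor T) t.
Proof.
move=> T0 t0; have [m m0 rho_T] := power_density_shift T0.
have /andP[k0 _] := shift_factor_itv T0; have wrho := density_weight drho.
rewrite /rho_shift tail_massE // (self_similar_tail wrho k0 m0 rho_T).
by rewrite mass_density // mule1 /= -[t + T]/(shift T t) rho_T // mulrC mulKf // gt_eqF.
Qed.

Lemma cvg_shift_factor : shift_factor T @[T --> +oo] --> 0^'+.
Proof.
apply: cvg_to_at_right.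
  near=> T; have T0 : 0 <= T by near: T; exact: nbhs_pinfty_ge.
  by have /andP[] := shift_factor_itv T0.
rewrite -[0](mulr0 al); apply: cvgMl_tmp; apply/gtr0_cvgV0.
  by near=> T; apply: affine_gt0; near: T; exact: nbhs_pinfty_ge.
by apply: cvg_comp (@cvg_addrl R al); apply: gt0_cvgMry => //; exact: cvg_id.
Unshelve. all: by end_near. Qed.

Definition factor_shift (l : R) : R := (al / l - al) / be.

Lemma factor_shiftK l : 0 < l -> shift_factor (factor_shift l) = l.
Proof.
move=> l0; rewrite /shift_factor /factor_shift [be * _]mulrC divfK ?gt_eqF // addrC subrK.
by field; rewrite !gt_eqF.
Qed.

Lemma cvg_factor_shift : factor_shift l @[l --> 0^'+] --> +oo.
Proof.
apply: gt0_cvgMly; first by rewrite invr_gt0.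
apply: cvg_comp (@cvg_addrr R (- al)).
by apply: gt0_cvgMry => //; exact: cvg_invr_at_right.
Qed.

Lemma shift_scaling_cvg (X : choiceType) (Om : set X) (V : (R -> R) -> X -> R) U :
  switching_value Om V ->
  {uniform Om, (fun T => V (rho_shift rho T)) @ +oo --> U} <->
  {uniform Om, (fun l => V (rho_scale rho l)) @ 0^'+ --> U}.
Proof.
move=> sV; have wrho := density_weight drho.
have V_shift T : 0 <= T -> V (rho_shift rho T) = V (rho_scale rho (shift_factor T)).
  move=> T0; have /andP[k0 _] := shift_factor_itv T0.
  have wk := weight_rho_scale k0 wrho.
  apply: (eq_switching_value sV) => // [|t /ltW t0]; last exact: rho_shift_scale.
  by apply: eq_weight wk => t t0; rewrite rho_shift_scale.
split=> VU.
  apply: near_eq_uniform_cvg (cvg_comp _ _ cvg_factor_shift VU).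
  near=> l; have l0 : 0 < l by near: l; exact: nbhs_right_gt.
  have T0 : 0 <= factor_shift l by near: l; exact: (cvg_factor_shift (nbhs_pinfty_ge (num_real 0))).
  by rewrite /= V_shift // factor_shiftK.
apply: near_eq_uniform_cvg (cvg_comp _ _ cvg_shift_factor VU).
by near=> T; rewrite V_shift //; near: T; exact: nbhs_pinfty_ge.
Unshelve. all: by end_near. Qed.

End PowerDensity.

Section PowerDensityExists.
Variable R : realType.
Local Notation leb := (@lebesgue_measure R).
Implicit Types x t : R.

Lemma add1_gt0 x : 0 <= x -> 0 < 1 + x. Proof. by move=> x0; rewrite ltr_pwDl. Qed.

Lemma is_derive_opp_inv1D x : 0 <= x ->
  is_derive x (1 : R) (fun x => - (1 + x)^-1) ((1 + x) ^+ 2)^-1.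
Proof.
move=> x0; have nz : 1 + x != 0 by rewrite gt_eqF // add1_gt0.
have d1 : is_derive x (1 : R) (fun x : R => 1 + x) (1 : R).
  by apply: (is_derive_eq (is_deriveD (is_derive_cst _ _ _) (is_derive_id _ _))); rewrite add0r.
apply: (is_derive_eq (is_deriveN (is_deriveV nz d1))).
by rewrite /GRing.scale /= mulr1 opprK.
Qed.

Lemma continuous_inv_sqr1D :
  {within `[0 : R, +oo[, continuous (fun x : R => ((1 + x) ^+ 2)^-1)}.
Proof.
apply: continuous_in_subspaceT => x /set_mem /=; rewrite in_itv /= andbT => x0.
have c1 : (1 + y : R) @[y --> x] --> (1 + x : R) by apply: cvgD; [exact: cvg_cst|exact: cvg_id].
apply: cvgV; first by rewrite expf_neq0 // gt_eqF // add1_gt0.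
by rewrite expr2; under eq_fun do rewrite expr2; apply: cvgM.
Qed.

Lemma integral_inv_sqr1D : (\int[leb]_(t in @Rplus R) (((1 + t) ^+ 2)^-1)%:E = 1)%E.
Proof.
rewrite RplusE (@ge0_continuous_FTC2y _ _ (fun x => - (1 + x)^-1) 0 0) //.
- by rewrite addr0 invr1 EFinN oppeK add0e.
- by move=> x x0; rewrite invr_ge0 sqr_ge0.
- exact: continuous_inv_sqr1D.
- rewrite -oppr0; apply: cvgN; apply/gtr0_cvgV0; last exact: cvg_addrl.
  by near=> x; apply: add1_gt0; near: x; exact: nbhs_pinfty_ge.
- by move=> x /ltW /is_derive_opp_inv1D[].
- apply: cvgN; apply: cvgV; first by rewrite addr0 oner_neq0.
  by apply: cvg_at_right_filter; apply: cvgD; [exact: cvg_cst|exact: cvg_id].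
- move=> x; rewrite in_itv /= andbT => /ltW /is_derive_opp_inv1D[_ dx].
  by rewrite derive1E dx.
Unshelve. all: by end_near. Qed.

Lemma power_density_exists : exists rho : R -> R, power_density rho.
Proof.
pose rho t : R := (1 + 1 * t) `^ (- 2); exists rho.
split; last by exists 1, 1, 2; rewrite !ltr01 ltr0n.
have rhoE t : 0 <= t -> rho t = ((1 + t) ^+ 2)^-1.
  by move=> t0; rewrite /rho mul1r powRN powR_mulrn // ltW // add1_gt0.
split=> [t _|]; first exact: powR_ge0.
split; last by rewrite -[LHS]/(mass rho) (eq_mass rhoE); exact: integral_inv_sqr1D.
apply: (eq_measurable_fun (fun t => ((1 + t) ^+ 2)^-1)).
  by move=> t; rewrite inE => /rhoE.
rewrite RplusE; apply: subspace_continuous_measurable_fun continuous_inv_sqr1D.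
exact: measurable_itv.
Qed.

End PowerDensityExists.

Section LimitValues.
Variables (R : realType) (X : choiceType) (Om : set X) (V : (R -> R) -> X -> R) (U : X -> R).
Hypothesis sV : switching_value Om V.
Local Notation varpi_limit := {uniform Om, (fun T => V (varpi T)) @ +oo --> U}.

Lemma exp_limitP :
  varpi_limit <-> {uniform Om, (fun l => V (pi_exp l)) @ 0^'+ --> U}.
Proof. by apply: iff_sym; exact: tauberian_density_limitP U sV (tauberian_exp_density R). Qed.

Lemma power_limitP rho : power_density rho ->
  varpi_limit <-> {uniform Om, (fun T => V (rho_shift rho T)) @ +oo --> U}.
Proof.
move=> [drho [al [be [ga [al0 [be0 [ga0 rhoE]]]]]]]; apply: iff_sym.
apply: iff_trans (shift_scaling_cvg al0 be0 rhoE drho U sV) _.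
exact: tauberian_density_limitP U sV (tauberian_power_density al0 be0 ga0 rhoE drho).
Qed.

Lemma density_limit mu : density mu -> varpi_limit ->
  {uniform Om, (fun l => V (rho_scale mu l)) @ 0^'+ --> U}.
Proof.
move=> dmu VU; apply/(scaling_limit_density Om V U dmu)/(abelian sV VU).
exact: density_weight.
Qed.

Lemma piecewise_continuous_limitP : varpi_limit <->
  forall mu, density mu -> piecewise_continuous mu ->
    {uniform Om, (fun l => V (rho_scale mu l)) @ 0^'+ --> U}.
Proof.
split=> [VU mu dmu _|VU]; first exact: density_limit.
apply: (varpi_scaling_cvg sV); apply: VU; first exact: density_varpi.
exact: piecewise_continuous_varpi.
Qed.

End LimitValues.

Theorem theorem4 (R : realType) (n p q : nat)
  (A : set 'rV[R]_p) (B : set 'rV[R]_q)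
  (f : 'rV[R]_n -> 'rV[R]_p -> 'rV[R]_q -> 'rV[R]_n)
  (g : 'rV[R]_n -> 'rV[R]_p -> 'rV[R]_q -> R)
  (Om : set 'rV[R]_n) :
  A !=set0 -> compact A -> B !=set0 -> compact B ->
  {within [set z : 'rV[R]_n * 'rV[R]_p * 'rV[R]_q | A z.1.2 /\ B z.2],
     continuous (fun z => f z.1.1 z.1.2 z.2)} ->
  {within [set z : 'rV[R]_n * 'rV[R]_p * 'rV[R]_q | A z.1.2 /\ B z.2],
     continuous (fun z => g z.1.1 z.1.2 z.2)} ->
  (forall x a b, A a -> B b -> 0 <= g x a b <= 1) ->
  (exists L : R, 0 < L /\ forall x y a b, A a -> B b ->
     `|f x a b - f y a b| + `|g x a b - g y a b| <= L * `|x - y|) ->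
  Om !=set0 ->
  (forall x0 a b t, Om x0 -> control A a -> control B b -> 0 <= t ->
     Om (traj f x0 a b t)) ->
  let V := value A B f g in
  let Cc U := forall mu : R -> R, density mu -> piecewise_continuous mu ->
      (fun lam => sup_dev Om (V (rho_scale mu lam)) U) @ 0^'+ --> 0%E in
  let Cu U := (fun T => sup_dev Om (V (varpi T)) U) @ +oo --> 0%E in
  let Ce U := (fun lam => sup_dev Om (V (pi_exp lam)) U) @ 0^'+ --> 0%E in
  let Cp rho U := (fun T => sup_dev Om (V (rho_shift rho T)) U) @ +oo --> 0%E in
  (forall U : 'rV[R]_n -> R, (forall w, Om w -> 0 <= U w <= 1) ->
     (Cc U <-> Cu U) /\ (Cu U <-> Ce U) /\
     (Ce U <-> (exists rho : R -> R, power_density rho /\ Cp rho U)) /\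
     ((exists rho : R -> R, power_density rho /\ Cp rho U) <->
        (forall rho : R -> R, power_density rho -> Cp rho U))) /\
  (forall mu rho : R -> R, density mu -> piecewise_continuous mu -> power_density rho ->
     (exists U : 'rV[R]_n -> R, Cu U \/ Ce U \/ Cp rho U) ->
     exists U : 'rV[R]_n -> R,
       (forall mu' : R -> R, density mu' -> piecewise_continuous mu' ->
          (fun lam => sup_dev Om (V (rho_scale mu' lam)) U) @ 0^'+ --> 0%E) /\
       Cu U /\ Ce U /\ (forall rho' : R -> R, power_density rho' -> Cp rho' U)).
Proof.
move=> A0 cA B0 cB cf cg g01 [L [L0 lip_fg]] O0 invariant V Cc Cu Ce Cp.
have lip_f x y u v : A u -> B v -> `|f x u v - f y u v| <= L * `|x - y|.
  by move=> Au Bv; apply: le_trans (lip_fg x y u v Au Bv); rewrite lerDl.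
have sV : switching_value Om V := value_switching cA cB cf L0 lip_f cg g01 A0 B0 invariant.
have CuP U : Cu U <-> {uniform Om, (fun T => V (varpi T)) @ +oo --> U} by exact: sup_dev_cvgP.
have CuCe U : Cu U <-> Ce U.
  by apply: iff_trans (CuP U) (iff_trans (exp_limitP U sV) _); apply: iff_sym; exact: sup_dev_cvgP.
have CuCp rho U : power_density rho -> Cu U <-> Cp rho U.
  move=> prho; apply: iff_trans (CuP U) (iff_trans (power_limitP U sV prho) _).
  by apply: iff_sym; exact: sup_dev_cvgP.
have CuCc U : Cu U <-> Cc U.
  apply: iff_trans (CuP U) (iff_trans (piecewise_continuous_limitP U sV) _).
  by split=> VU mu dmu pmu; apply/sup_dev_cvgP => //; exact: VU.
have [rho0 prho0] := power_density_exists R.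
have CuSome U : Cu U <-> exists rho, power_density rho /\ Cp rho U.
  split=> [CU|[rho [prho CpU]]]; last exact: (CuCp rho U prho).2 CpU.
  by exists rho0; split; [exact: prho0|exact: (CuCp rho0 U prho0).1 CU].
have CuAll U : Cu U <-> forall rho, power_density rho -> Cp rho U.
  split=> [CU rho prho|CpU]; first exact: (CuCp rho U prho).1 CU.
  exact: (CuCp rho0 U prho0).2 (CpU rho0 prho0).
split=> [U _|mu rho _ _ prho [U HU]].
  by rewrite -CuCc -CuCe -CuSome -CuAll.
have CU : Cu U by case: HU => [|[/(CuCe U).2|/(CuCp rho U prho).2]]; exact.
exists U; split; [exact: (CuCc U).1 CU|split; [exact: CU|]].
by split; [exact: (CuCe U).1 CU|exact: (CuAll U).1 CU].
Qed.
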